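(* The $C_0$-semigroup $\{\mathcal{S}(t)\}_{t\ge 0}$ on $\mathcal{H}$ generated by the operator $\mathcal{A}$ defined in the context is not exponentially stable; that is, there are no constants $K\geq 1$, $\omega>0$ with $\|\mathcal{S}(t)\|_{\mathcal{L}(\mathcal{H})}\le Ke^{-\omega t}$ for all $t\ge 0$.
   Context: Let $\rho,\alpha,\beta,\gamma,\mu,L,l_1,l_2,\eta>0$ and $0<a<1$ be constants with $\alpha=\alpha_1+\gamma^2\beta$, where $\alpha_1>0$. Put $\varpi(\xi)=|\xi|^{(2a-1)/2}$ for $\xi\in\mathbb{R}$. Functions are complex-valued. Let $H^1_*(0,L)=\{f\in H^1(0,L): f(0)=0\}$ and $$\mathcal{H}=H^1_*(0,L)\times L^2(0,L)\times L^2(\mathbb{R})\times H^1_*(0,L)\times L^2(0,L)\times L^2(\mathbb{R}),$$ with inner product, for $U_i=(V_i,f_i,\phi_{1,i},P_i,g_i,\phi_{2,i})$, $i=1,2$, $$\langle U_1,U_2\rangle_{\mathcal{H}}=\int_0^L\left[\rho f_1\overline{f_2}+\mu g_1\overline{g_2}+\alpha_1V_{1,x}\overline{V_{2,x}}+\beta(\gamma V_{1,x}-P_{1,x})\overline{(\gamma V_{2,x}-P_{2,x})}\right]dx+\frac{\sin(a\pi)}{\pi}\int_{-\infty}^{+\infty}\left(l_1\phi_{1,1}\overline{\phi_{1,2}}+l_2\phi_{2,1}\overline{\phi_{2,2}}\right)d\xi .$$ For $U=(V,f,\phi_1,P,g,\phi_2)$ define $$\mathcal{A}U=\Big(f,\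 \tfrac{\alpha}{\rho}V_{xx}-\tfrac{\gamma\beta}{\rho}P_{xx},\ -(\xi^2+\eta)\phi_1+f(L)\varpi(\xi),\ g,\ -\tfrac{\gamma\beta}{\mu}V_{xx}+\tfrac{\beta}{\mu}P_{xx},\ -(\xi^2+\eta)\phi_2+g(L)\varpi(\xi)\Big),$$ with domain $\mathcal{D}(\mathcal{A})$ the set of $U\in\mathcal{H}$ such that $V,P\in H^2(0,L)\cap H^1_*(0,L)$, $f,g\in H^1_*(0,L)$, $|\xi|\phi_1,|\xi|\phi_2\in L^2(\mathbb{R})$, $-(\xi^2+\eta)\phi_1+f(L)\varpi\in L^2(\mathbb{R})$, $-(\xi^2+\eta)\phi_2+g(L)\varpi\in L^2(\mathbb{R})$, and $$\alpha V_x(L)-\gamma\beta P_x(L)=-l_1\frac{\sin(a\pi)}{\pi}\int_{-\infty}^{\infty}\varpi(\xi)\phi_1(\xi)\,d\xi,\qquad \beta P_x(L)-\gamma\beta V_x(L)=-l_2\frac{\sin(a\pi)}{\pi}\int_{-\infty}^{\infty}\varpi(\xi)\phi_2(\xi)\,d\xi .$$ The operator $\mathcal{A}$ generates a $C_0$-semigroup of contractions on $\mathcal{H}$, denoted $\{\mathcal{S}(t)\}_{t\ge0}$. *)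

(* Defs.v *)
From HB Require Import structures.
From mathcomp Require Import all_boot all_order all_algebra.
From mathcomp Require Import complex.
From mathcomp Require Import all_classical all_reals all_analysis.

Set Implicit Arguments.
Unset Strict Implicit.
Unset Printing Implicit Defensive.

Import Order.TTheory GRing.Theory Num.Theory.
Import numFieldNormedType.Exports.

Local Open Scope classical_set_scope.
Local Open Scope ring_scope.
Local Open Scope complex_scope.

(* Elements of L^2 and of the Sobolev spaces are represented by functions;
   equality in these spaces is equality almost everywhere. *)

Section ComplexL2.
Variable R : realType.
Implicit Types (D : set R) (f g : R -> R[i]).

Definition cint D f : R[i] :=
  (\int[@lebesgue_measure R]_(x in D) complex.Re (f x))
  +i* (\int[@lebesgue_measure R]_(x in D) complex.Im (f x)).

Definition L2 D f : Prop :=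
  [/\ measurable_fun D (fun x => complex.Re (f x)),
      measurable_fun D (fun x => complex.Im (f x)) &
      (@lebesgue_measure R).-integrable D
        (fun x => (complex.Re (f x) ^+ 2 + complex.Im (f x) ^+ 2)%:E)].

End ComplexL2.

Section Sobolev.
Variables (R : realType) (L : R).
Implicit Types (u v w h : R -> R[i]) (phi : R -> R).

Definition C1c phi : Prop :=
  [/\ forall x, derivable phi x 1,
      continuous (derive1 phi) &
      exists c d, [/\ 0 < c, d < L & forall x, ~ (c <= x <= d) -> phi x = 0]].

(* Test functions of class C^1_c, as in Brezis' definition of W^{1,p}(I). *)
Definition is_wderiv v w : Prop :=
  forall phi, C1c phi ->
    cint `]0, L[ (fun x => v x * (derive1 phi x)%:C) =
    - cint `]0, L[ (fun x => w x * (phi x)%:C).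

Definition H1 v : Prop :=
  L2 `]0, L[ v /\ exists2 w, L2 `]0, L[ w & is_wderiv v w.

(* v_x, determined up to a.e. equality when v is in H^1(0,L) *)
Definition wderiv v : R -> R[i] :=
  xget (cst 0) [set w | L2 `]0, L[ w /\ is_wderiv v w].

(* The continuous representative of v on [0,L]: the values v(0), v(L) of an H^1
   function are the values of crep v. *)
Definition crep v : R -> R[i] :=
  xget (cst 0) [set h |
    [/\ {within `[0, L], continuous (fun x => complex.Re (h x))},
        {within `[0, L], continuous (fun x => complex.Im (h x))} &
        ae_eq (@lebesgue_measure R) `]0, L[%classic h v]].

Definition H1s v : Prop := H1 v /\ crep v 0 = 0.

Definition H2 v : Prop := H1 v /\ H1 (wderiv v).

End Sobolev.

(* C_0-semigroups on a complex normed space presented by representatives: the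
   points are the elements of H modulo eqH, and nrm is the norm of a class. *)
Section Semigroup.
Variables (R : realType) (X : lmodType R[i]).
Variables (H : set X) (eqH : X -> X -> Prop) (nrm : X -> R).
Implicit Types (S : R -> X -> X) (U W : X) (t s : R).

Record C0_semigroup S : Prop := {
  C0_stable : forall t U, 0 <= t -> H U -> H (S t U);
  C0_compat : forall t U W, 0 <= t -> H U -> H W ->
    eqH U W -> eqH (S t U) (S t W);
  C0_linear : forall t (c : R[i]) U W, 0 <= t -> H U -> H W ->
    eqH (S t (c *: U + W)) (c *: S t U + S t W);
  C0_bounded : forall t, 0 <= t ->
    exists M : R, forall U, H U -> nrm (S t U) <= M * nrm U;
  C0_zero : forall U, H U -> eqH (S 0 U) U;
  C0_add : forall t s U, 0 <= t -> 0 <= s -> H U ->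
    eqH (S (t + s) U) (S t (S s U));
  C0_continuous : forall U, H U ->
    nrm (S t U - U) @[t --> 0^'+] --> (0 : R) }.

(* W is the value at U of the infinitesimal generator of S. *)
Definition generator S U W : Prop :=
  nrm (((t^-1)%:C : R[i]) *: (S t U - U) - W) @[t --> 0^'+] --> (0 : R).

Definition generated_by S (D : set X) (A : X -> X) : Prop :=
  forall U W, H U -> H W -> (generator S U W <-> D U /\ eqH (A U) W).

Definition opnorm (T : X -> X) : \bar R :=
  ereal_sup [set (nrm (T U))%:E | U in [set U | H U /\ nrm U <= 1]].

Definition exponentially_stable S : Prop :=
  exists K omega : R, [/\ 1 <= K, 0 < omega &
    forall t, 0 <= t -> (opnorm (S t) <= (K * expR (- omega * t))%:E)%E].

End Semigroup.

Section Beam.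
Variable R : realType.
Variables rho alpha alpha1 beta gamma mu L l1 l2 eta a : R.

Local Notation F := (R -> R[i]).

(* (V, f, phi1, P, g, phi2) *)
Definition state : Type := (F * F * F * F * F * F)%type.

Definition varpi (xi : R) : R := `|xi| `^ ((2 * a - 1) / 2).

Definition Hsp : set state := [set U |
  let: (V, f, phi1, P, g, phi2) := U in
  [/\ H1s L V, L2 `]0, L[ f & L2 setT phi1] /\
  [/\ H1s L P, L2 `]0, L[ g & L2 setT phi2]].

Definition eqHsp (U1 U2 : state) : Prop :=
  let: (V1, f1, phi11, P1, g1, phi21) := U1 in
  let: (V2, f2, phi12, P2, g2, phi22) := U2 in
  let m := @lebesgue_measure R in
  [/\ ae_eq m `]0, L[%classic V1 V2, ae_eq m `]0, L[%classic f1 f2 & ae_eq m setT phi11 phi12] /\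
  [/\ ae_eq m `]0, L[%classic P1 P2, ae_eq m `]0, L[%classic g1 g2 & ae_eq m setT phi21 phi22].

Definition inner (U1 U2 : state) : R[i] :=
  let: (V1, f1, phi11, P1, g1, phi21) := U1 in
  let: (V2, f2, phi12, P2, g2, phi22) := U2 in
  let: (V1x, P1x) := (wderiv L V1, wderiv L P1) in
  let: (V2x, P2x) := (wderiv L V2, wderiv L P2) in
  cint `]0, L[ (fun x =>
    rho%:C * f1 x * conjc (f2 x) + mu%:C * g1 x * conjc (g2 x)
    + alpha1%:C * V1x x * conjc (V2x x)
    + beta%:C * (gamma%:C * V1x x - P1x x)
              * conjc (gamma%:C * V2x x - P2x x))
  + (sin (a * pi) / pi)%:C * cint setT (fun xi =>
      l1%:C * phi11 xi * conjc (phi12 xi) + l2%:C * phi21 xi * conjc (phi22 xi)).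

Definition normH (U : state) : R := Num.sqrt (complex.Re (inner U U)).

(* third and sixth components of A: phi is phi1 or phi2, and c is f(L) or g(L) *)
Definition diffusive (phi : F) (c : R[i]) : F :=
  fun xi => - (xi ^+ 2 + eta)%:C * phi xi + c * (varpi xi)%:C.

Definition domA : set state := [set U | Hsp U /\
  let: (V, f, phi1, P, g, phi2) := U in
  let: (Vx, Px) := (crep L (wderiv L V), crep L (wderiv L P)) in
  [/\ H2 L V /\ H1s L V, H2 L P /\ H1s L P, H1s L f & H1s L g] /\
  [/\ L2 setT (fun xi => `|xi|%:C * phi1 xi),
      L2 setT (fun xi => `|xi|%:C * phi2 xi),
      L2 setT (diffusive phi1 (crep L f L)) &
      L2 setT (diffusive phi2 (crep L g L))] /\
  alpha%:C * Vx L - (gamma * beta)%:C * Px L =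
    - (l1 * (sin (a * pi) / pi))%:C
      * cint setT (fun xi => (varpi xi)%:C * phi1 xi) /\
  beta%:C * Px L - (gamma * beta)%:C * Vx L =
    - (l2 * (sin (a * pi) / pi))%:C
      * cint setT (fun xi => (varpi xi)%:C * phi2 xi)].

Definition opA (U : state) : state :=
  let: (V, f, phi1, P, g, phi2) := U in
  let: (Vxx, Pxx) := (wderiv L (wderiv L V), wderiv L (wderiv L P)) in
  (f,
   (fun x => (alpha / rho)%:C * Vxx x - (gamma * beta / rho)%:C * Pxx x) : F,
   diffusive phi1 (crep L f L),
   g,
   (fun x => - (gamma * beta / mu)%:C * Vxx x + (beta / mu)%:C * Pxx x) : F,
   diffusive phi2 (crep L g L)).

End Beam.

(* Main.v *)
Require Import Defs.
From HB Require Import structures.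
From mathcomp Require Import all_boot all_order all_algebra.
From mathcomp Require Import complex ring lra.
From mathcomp Require Import all_classical all_reals all_analysis.
From mathcomp Require Import measurable_realfun.

Set Implicit Arguments.
Unset Strict Implicit.
Unset Printing Implicit Defensive.

Import Order.TTheory GRing.Theory Num.Theory.
Import numFieldNormedType.Exports.
Import Normc.

Local Open Scope classical_set_scope.
Local Open Scope ring_scope.
Local Open Scope complex_scope.

(** The damping acts only through the boundary x = L, and through a fractional
    derivative of order less than one. At frequency lam the diffusive variables
    are phi_1 = f(L) varpi / (i lam + xi^2 + eta) and the like, so the boundary
    feedback is multiplied by the integral J(lam) of
    varpi^2 / (i lam + xi^2 + eta), which tends to 0 as lam grows
    (cvg_varpi_kernel): high-frequency waves are hardly damped. This produces
    quasi-modes U of norm bounded below with (A - i lam) U arbitrarily small,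
    and these preclude exponential decay.

    For the last implication, let S be the semigroup, bounded by K. With
    c = 1 + i lam h, the error S(h) U - c U has norm at most h (eps + o(1)),
    where eps is the norm of (A - i lam) U; as |c| >= 1, each step of length h
    decreases the norm of the orbit by at most K times this error. Hence
    |S(t) U| >= |U| - t K eps, against exponential decay
    (semigroup_nrm_steps, quasimodes_not_exponentially_stable).

    The quasi-modes are V = V0 + y V1 and P = P0 + y P1 with y = - i J(lam),
    f = i lam V and g = i lam P. The pair (V0, P0) is a standing wave of one of
    the two families of the undamped system, with zero flux at L. The real
    corrector (V1, P1) vanishes at 0 and L and carries the flux required by the
    feedback; it combines the profiles x sin (k (x - L)) / (L k), with k the wave
    number of each family at frequency lam. Such profiles solve the wave
    equations up to a term bounded independently of lam, so that the residual is
    O(y) (antinode_quasimode, quasimode_spec).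

    The weak derivative and the continuous representative that enter H are
    picked by a choice operator. Uniqueness of the weak derivative is the fundamental
    lemma of the calculus of variations (fundamental_lemma); with it the norm of
    H is computed from any weak derivative (normH_sqr) and is a seminorm
    (normHZ, normHD). Existence of a continuous representative is never used:
    only differences S(t) U - c U with U smooth have to belong to H, and there
    the trace at 0 is additive (H1s_addl). *)

(** * Quasi-modes and exponential stability *)

Section QuasiModes.
Variables (R : realType) (X : lmodType R[i]).
Variables (H Hl : set X) (eqH : X -> X -> Prop) (nrm : X -> R).
Variable S : R -> X -> X.
Hypothesis C0 : C0_semigroup H eqH nrm S.
Hypothesis nrm_ge0 : forall x, 0 <= nrm x.
Hypothesis HlH : H `<=` Hl.
Hypothesis Hl_lin : forall (c : R[i]) x y, Hl x -> Hl y -> Hl (c *: x + y).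
Hypothesis nrmZ : forall (c : R[i]) x, Hl x -> nrm (c *: x) = normc c * nrm x.
Hypothesis nrmD : forall x y, Hl x -> Hl y -> nrm (x + y) <= nrm x + nrm y.
Hypothesis nrm_eqH : forall x y, Hl x -> Hl y -> eqH x y -> nrm x = nrm y.
Hypothesis H_0 : H 0.
Hypothesis H_scale : forall (c : R[i]) x, H x -> H (c *: x).

Let nrm0 : nrm 0 = 0.
Proof.
have := nrmZ 0 (HlH H_0); rewrite scale0r normc0 mul0r; exact.
Qed.

Let Hl_scale (c : R[i]) x : Hl x -> Hl (c *: x).
Proof. by move=> hx; rewrite -[_ *: _]addr0; apply: Hl_lin => //; apply: HlH. Qed.

Lemma semigroup_nrm_scale t (c : R[i]) x : 0 <= t -> H x ->
  nrm (S t (c *: x)) = normc c * nrm (S t x).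
Proof.
move=> t0 hx.
have S0 : nrm (S t 0) = 0.
  have [M hM] := C0_bounded C0 t0; have := hM 0 H_0; rewrite nrm0 mulr0 => h.
  by apply/eqP; rewrite eq_le h nrm_ge0.
have hSx : Hl (S t x) by apply/HlH/(C0_stable C0).
have hS0 : Hl (S t 0) by apply/HlH/(C0_stable C0).
have hcx : H (c *: x) by exact: H_scale.
have e : nrm (S t (c *: x)) = nrm (c *: S t x + S t 0).
  rewrite -{1}[c *: x]addr0; apply: nrm_eqH; last exact: (C0_linear C0).
    by apply/HlH/(C0_stable C0); rewrite // addr0.
  exact: Hl_lin.
apply/eqP; rewrite e eq_le; apply/andP; split.
  by apply: (le_trans (nrmD _ _)); rewrite ?S0 ?addr0 ?nrmZ//; exact: Hl_scale.
rewrite -nrmZ//.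
have := nrmD (Hl_lin c hSx hS0) (Hl_scale (-1) hS0).
by rewrite (nrmZ _ hS0) S0 mulr0 addr0 scaleN1r addrK.
Qed.

Lemma semigroup_nrm_le_opnorm t (k : R) x : 0 <= t -> H x ->
  (opnorm H nrm (S t) <= k%:E)%E -> nrm (S t x) <= k * nrm x.
Proof.
move=> t0 hx hk.
have [x0|x0] := eqVneq (nrm x) 0.
  by have [M /(_ x hx)] := C0_bounded C0 t0; rewrite x0 !mulr0.
have xp : 0 < nrm x by rewrite lt_neqAle eq_sym x0 nrm_ge0.
pose c : R[i] := (nrm x)^-1%:C.
have nc : normc c = (nrm x)^-1.
  by rewrite /c /normc /= expr0n addr0 sqrtr_sqr ger0_norm// invr_ge0 ltW.
have : ((nrm (S t (c *: x)))%:E <= k%:E)%E.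
  apply: le_trans hk; apply: ereal_sup_ubound; exists (c *: x) => //; split.
    exact: H_scale.
  by rewrite nrmZ ?nc ?mulVf//; exact: HlH.
by rewrite lee_fin semigroup_nrm_scale// nc mulrC ler_pdivrMr.
Qed.

(** Explicit Euler steps for x' = i lam x: since |1 + i lam h| >= 1, each step
    lowers the norm along the orbit of x by at most the image of the consistency
    error, and no complex exponential is needed. *)
Lemma semigroup_nrm_steps (K h lam : R) x n : 0 <= h -> 0 <= K -> H x ->
  H (S h x - (1 +i* (lam * h)) *: x) ->
  (forall t y, 0 <= t -> H y -> nrm (S t y) <= K * nrm y) ->
  nrm x - n%:R * (K * nrm (S h x - (1 +i* (lam * h)) *: x))
    <= nrm (S (n%:R * h) x).
Proof.
move=> h0 K0 hx; set c := (1 +i* _); set e := S h x - _ => he hK.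
have nc : 1 <= normc c.
  rewrite /c /normc expr1n -[leLHS]sqrtr1 ler_sqrt ?addr_ge0 ?ler01 ?sqr_ge0//.
  by rewrite lerDl sqr_ge0.
elim: n => [|n IH].
  rewrite !mul0r subr0 le_eqVlt; apply/orP; left; apply/eqP/esym.
  by apply: nrm_eqH; [exact/HlH/(C0_stable C0)|exact: HlH|exact: (C0_zero C0)].
have nh0 : 0 <= n%:R * h by rewrite mulr_ge0.
have hSn : H (S (n%:R * h) x) by exact: (C0_stable C0).
have Sh : H (S h x) by exact: (C0_stable C0).
have e1 : nrm (S (n.+1%:R * h) x) = nrm (c *: S (n%:R * h) x + S (n%:R * h) e).
  rewrite -natr1 mulrDl mul1r.
  transitivity (nrm (S (n%:R * h) (S h x))).
    apply: nrm_eqH; last exact: (C0_add C0).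
      by apply/HlH/(C0_stable C0) => //; rewrite addr_ge0.
    by apply/HlH/(C0_stable C0).
  have -> : S h x = c *: x + e by rewrite /e addrC subrK.
  apply: nrm_eqH; last exact: (C0_linear C0).
    apply/HlH/(C0_stable C0) => //.
    by rewrite /e addrC subrK.
  by apply: Hl_lin; apply/HlH => //; exact: (C0_stable C0).
have e2 : normc c * nrm (S (n%:R * h) x) <=
    nrm (S (n.+1%:R * h) x) + K * nrm e.
  have hSe : Hl (S (n%:R * h) e) by apply/HlH/(C0_stable C0).
  have hcS : Hl (c *: S (n%:R * h) x) by apply/Hl_scale/HlH.
  rewrite -nrmZ ?e1; last exact: HlH.
  have := nrmD (Hl_lin c (HlH hSn) hSe) (Hl_scale (-1) hSe).
  rewrite (nrmZ _ hSe) normcN normc1 mul1r scaleN1r addrK => h1.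
  by apply: (le_trans h1); rewrite lerD2l; exact: hK.
have e3 : nrm (S (n%:R * h) x) <= normc c * nrm (S (n%:R * h) x).
  by rewrite ler_peMl.
have -> : n.+1%:R * (K * nrm e) = n%:R * (K * nrm e) + K * nrm e.
  by rewrite -natr1 mulrDl mul1r.
by rewrite opprD addrA lerBlDr (le_trans IH)// (le_trans e3).
Qed.

(** The easy half of the Gearhart-Pruss theorem: approximate eigenvectors of the
    generator, for points of the imaginary axis, rule out exponential decay. The
    seminorm nrm lives on a linear space Hl containing H; the set H itself need
    not be closed under addition, only under scalar multiples and the
    differences S t x - c x. *)
Theorem quasimodes_not_exponentially_stable (delta : R) : 0 < delta ->
  (forall eps : R, 0 < eps -> exists x w lam,
    [/\ H x, Hl w & forall t (c : R[i]), 0 <= t -> H (S t x - c *: x)] /\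
    [/\ generator nrm S x w, delta <= nrm x &
        nrm (w - (0 +i* lam) *: x) <= eps]) ->
  ~ exponentially_stable H nrm S.
Proof.
move=> delta0 qm [K [omega [K1 omega0 Kexp]]].
have K0 : 0 < K by exact: lt_le_trans K1.
have SK t y : 0 <= t -> H y -> nrm (S t y) <= K * expR (- omega * t) * nrm y.
  by move=> t0 hy; apply: semigroup_nrm_le_opnorm => //; exact: Kexp.
have SK' t y : 0 <= t -> H y -> nrm (S t y) <= K * nrm y.
  move=> t0 hy; apply: (le_trans (SK _ _ t0 hy)).
  rewrite ler_wpM2r// ler_piMr ?(ltW K0)// -expR0 ler_expR.
  by rewrite mulNr oppr_le0 mulr_ge0// ltW.
(* a time T at which the decay estimate contracts norms by a factor 2 *)
pose T := ln (2 * K) / omega.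
have T0 : 0 < T by rewrite divr_gt0// ln_gt0//; lra.
have KT : K * expR (- omega * T) = 2^-1.
  rewrite /T mulNr mulrCA divff ?gt_eqF// mulr1 expRN lnK ?posrE ?mulr_gt0//.
  by rewrite invfM mulrCA divff ?gt_eqF// mulr1.
pose eps := delta / (8 * (K * T)).
have eps0 : 0 < eps by apply: divr_gt0 => //; rewrite mulr_gt0// mulr_gt0.
have [x [w [lam [[hx hw hS] [gxw xd we]]]]] := qm _ eps0.
have : \forall t \near 0^'+, nrm ((t^-1)%:C *: (S t x - x) - w) < eps.
  by have /cvgr0Pnorm_lt/(_ _ eps0) := gxw; apply: filterS => t;
    apply: le_lt_trans; exact: ler_norm.
move=> [e /= e0 he].
pose n := Num.truncn (T / e); pose h := T / n.+1%:R.
have h0 : 0 < h by rewrite divr_gt0.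
have he' : h < e.
  by rewrite ltr_pdivrMr// mulrC -ltr_pdivrMr// truncnS_gt.
have {he} hh : nrm ((h^-1)%:C *: (S h x - x) - w) < eps.
  by apply: he => //=; rewrite sub0r normrN gtr0_norm.
have nh : n.+1%:R * h = T by rewrite mulrC divfK ?pnatr_eq0.
set E := S h x - (1 +i* (lam * h)) *: x.
have hE : H E by exact: hS _ _ (ltW h0).
have hSx : Hl (S h x) by apply/HlH/(C0_stable C0) => //; exact: ltW.
have hX := HlH hx.
have hSxx : Hl (S h x - x).
  by rewrite addrC -scaleN1r; apply: Hl_lin.
have hwx : Hl (w - (0 +i* lam) *: x).
  by rewrite addrC -scaleNr; exact: Hl_lin.
have hSw : Hl ((h^-1)%:C *: (S h x - x) - w).
  by rewrite addrC -scaleN1r; apply: Hl_lin => //; exact: Hl_scale.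
have EE : E = h%:C *: (((h^-1)%:C *: (S h x - x) - w) + (w - (0 +i* lam) *: x)).
  rewrite addrA subrK scalerBr !scalerA -rmorphM divff ?gt_eqF//= scale1r.
  have cE : 1 +i* (lam * h) = 1 + h%:C * (0 +i* lam).
    by apply/eqP; rewrite eq_complex /=; apply/andP; split; apply/eqP; ring.
  by rewrite /E cE scalerDl scale1r opprD addrA.
have nE : nrm E <= h * (2 * eps).
  rewrite EE nrmZ; last by rewrite -[X in Hl (X + _)]scale1r; exact: Hl_lin.
  rewrite /normc /= expr0n addr0 sqrtr_sqr gtr0_norm// ler_pM2l//.
  apply: (le_trans (nrmD _ _)) => //.
  by rewrite mulr_natl mulr2n lerD// ltW.
have := semigroup_nrm_steps n.+1 (ltW h0) (ltW K0) hx hE SK'.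
rewrite nh => lo.
have hi : nrm (S T x) <= 2^-1 * nrm x by rewrite -KT; exact: SK (ltW T0) hx.
have e1 : n.+1%:R * (K * nrm E) <= K * T * (2 * eps).
  by rewrite -nh mulrCA -mulrA -(mulrA _ h) ler_pM2l// ler_pM2l.
have e2 : K * T * (2 * eps) = delta / 4.
  rewrite /eps; field.
  by rewrite !gt_eqF.
have e3 : n.+1%:R * (K * nrm E) <= delta / 4 by rewrite -e2.
have {}lo : nrm x - n.+1%:R * (K * nrm E) <= nrm (S T x) by [].
by move: e3 lo hi xd delta0; move: (_ * (K * nrm E)) (nrm x) (nrm (S T x)) => *; lra.
Qed.

End QuasiModes.

(** * Square-integrable real functions *)

Section RealL2.
Variable R : realType.
Local Notation mu := (@lebesgue_measure R).
Implicit Types (D : set R) (u v : R -> R).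

(** Square-integrable real functions on D. *)
Definition L2r D u : Prop :=
  measurable_fun D u /\ mu.-integrable D (fun x => (u x ^+ 2)%:E).

Lemma integrable_dominated D u v : measurable D -> measurable_fun D u ->
  (forall x, D x -> `|u x| <= v x) ->
  mu.-integrable D (EFin \o v) -> mu.-integrable D (EFin \o u).
Proof.
move=> mD mu_ uv iv; apply: le_integrable iv => //.
  exact/measurable_EFinP.
move=> x Dx /=; rewrite lee_fin; apply: (le_trans (uv _ Dx)).
exact: ler_norm.
Qed.

Lemma integrableDr D u v : measurable D -> mu.-integrable D (EFin \o u) ->
  mu.-integrable D (EFin \o v) -> mu.-integrable D (EFin \o (fun x => u x + v x)).
Proof. by move=> mD iu iv; apply: (eq_integrable _ _ _ _ (integrableD _ iu iv)). Qed.

Lemma integrableZr D u (k : R) : measurable D -> mu.-integrable D (EFin \o u) ->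
  mu.-integrable D (EFin \o (fun x => k * u x)).
Proof. by move=> mD iu; apply: (eq_integrable _ _ _ _ (integrableZl _ k iu)). Qed.

Lemma L2rM D u v : measurable D -> L2r D u -> L2r D v ->
  mu.-integrable D (EFin \o (fun x => u x * v x)).
Proof.
move=> mD [mu_ iu] [mv iv].
apply: (@integrable_dominated _ _ (fun x => u x ^+ 2 + v x ^+ 2)) => //.
- exact: measurable_funM.
- move=> x _; rewrite normrM -(real_normK (num_real (u x))).
  rewrite -(real_normK (num_real (v x))).
  have := normr_ge0 (u x); have := normr_ge0 (v x); nra.
- exact: integrableDr.
Qed.

Lemma L2r_lin D u v (k : R) : measurable D -> L2r D u -> L2r D v ->
  L2r D (fun x => k * u x + v x).
Proof.
move=> mD Lu Lv; have iuv := L2rM mD Lu Lv.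
move: Lu Lv => [mu_ iu] [mv iv]; split.
  by apply: measurable_funD => //; apply: measurable_funM.
have := integrableDr mD (integrableDr mD (integrableZr (k ^+ 2) mD iu)
  (integrableZr (2 * k) mD iuv)) iv.
by apply: eq_integrable => // x _ /=; congr EFin; ring.
Qed.

End RealL2.

Section Interval.
Variables (R : realType) (L : R).
Local Notation mu := (@lebesgue_measure R).
Implicit Types (u v : R -> R).

Lemma continuous_integrable_itv u : continuous u ->
  mu.-integrable `]0, L[ (EFin \o u).
Proof.
move=> cu; apply: (@integrableS _ _ _ mu `[0, L]%classic) => //.
  exact: subset_itv_oo_cc.
apply: continuous_compact_integrable; first exact: segment_compact.
exact: continuous_subspaceT.
Qed.

Lemma L2r_integrable u : L2r `]0, L[ u -> mu.-integrable `]0, L[ (EFin \o u).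
Proof.
move=> [mu_ iu].
apply: (@integrable_dominated _ _ _ (fun x => 1 + u x ^+ 2)) => //.
  move=> x _; rewrite -(real_normK (num_real (u x))).
  have := normr_ge0 (u x); nra.
apply: integrableDr => //.
exact: (@continuous_integrable_itv (cst 1)) (@cst_continuous _ _ _).
Qed.

Lemma continuous_L2r u : continuous u -> L2r `]0, L[ u.
Proof.
move=> cu; split.
  by apply: measurable_funTS; exact: continuous_measurable_fun.
apply: (@continuous_integrable_itv (fun x => u x ^+ 2)) => x.
by apply: cvgM; exact: cu.
Qed.

End Interval.

(** * Dominated convergence and bump functions *)

Section DominatedConvergence.
Variable R : realType.
Local Notation mu := (@lebesgue_measure R).

Lemma Rintegral_dominated_cvg (D : set R) (f_ : nat -> R -> R) (f g : R -> R) :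
  measurable D -> (forall n, measurable_fun D (f_ n)) ->
  (forall x, D x -> f_ n x @[n --> \oo] --> f x) ->
  mu.-integrable D (EFin \o g) -> (forall n x, D x -> `|f_ n x| <= g x) ->
  (\int[mu]_(x in D) f_ n x) @[n --> \oo] --> \int[mu]_(x in D) f x.
Proof.
move=> mD mf_ ff ig fg.
have mf : measurable_fun D f.
  exact: (measurable_fun_cvg mf_ ff).
have [] := @dominated_convergence _ _ _ mu D mD (fun n => EFin \o f_ n)
  (EFin \o f) (EFin \o g).
- by move=> n; apply/measurable_EFinP; exact: mf_.
- by apply/measurable_EFinP; exact: mf.
- apply: aeW => x Dx; apply: cvg_EFin; first exact: nearW.
  exact: ff.
- exact: ig.
- by apply: aeW => x n Dx; rewrite lee_fin fg.
move=> if_ _ cv; apply: fine_cvg; rewrite fineK//.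
exact: integrable_fin_num.
Qed.

End DominatedConvergence.

Section SquareBump.
Variable R : realType.
Implicit Types (x y c d : R).

Lemma is_derive_quadratic_remainder (f : R -> R) x l k :
  (forall h, `|f (x + h) - f x - l * h| <= k * h ^+ 2) -> is_derive x 1 f l.
Proof.
move=> fl.
have cv : h^-1 *: (f (h *: (1 : R) + x) - f x) @[h --> 0^'] --> l.
  apply/cvgrPdist_le => e e0.
  have k1 : 0 < `|k| + 1 by rewrite ltr_wpDl.
  near=> h.
  have h0 : h != 0 by near: h; exact: nbhs_dnbhs_neq.
  have hn : 0 < `|h| by rewrite normr_gt0.
  rewrite -(ler_pM2r hn) -normrM.
  have he : `|h| <= e / (`|k| + 1).
    near: h; apply: dnbhs0_le; exact: divr_gt0.
  have -> : (l - h^-1 *: (f (h *: (1 : R) + x) - f x)) * h =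
      - (f (x + h) - f x - l * h).
    by rewrite /GRing.scale /= mulr1 (addrC h x); field.
  rewrite normrN.
  apply: (le_trans (fl h)); rewrite -(real_normK (num_real h)) expr2 mulrA.
  rewrite ler_wpM2r//.
  apply: (@le_trans _ _ ((`|k| + 1) * `|h|)).
    rewrite ler_wpM2r// (le_trans (ler_norm _))// lerDl//.
  by rewrite mulrC -ler_pdivlMr.
split; first by apply/cvg_ex; exists l.
by apply/cvg_lim.
Unshelve. all: by end_near. Qed.

(** The positive part, whose square is of class C^1. *)
Definition pos_part y : R := (y + `|y|) / 2.

Lemma pos_part_le0 y : y <= 0 -> pos_part y = 0.
Proof. by move=> y0; rewrite /pos_part ler0_norm// addrN mul0r. Qed.

Lemma pos_part_ge0 y : 0 <= y -> pos_part y = y.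
Proof. by move=> y0; rewrite /pos_part ger0_norm//; field. Qed.

Lemma is_derive_pos_part_sqr y :
  is_derive y 1 (fun y => pos_part y ^+ 2) (2 * pos_part y).
Proof.
apply: (@is_derive_quadratic_remainder _ _ _ 1) => h.
have [y0|/ltW y0] := leP y 0; have [z0|/ltW z0] := leP (y + h) 0.
- rewrite !pos_part_le0//; rewrite expr0n/= mulr0 mul0r !subr0 normr0 mul1r.
  exact: sqr_ge0.
- rewrite (pos_part_le0 y0) (pos_part_ge0 z0) ger0_norm; nra.
- rewrite (pos_part_ge0 y0) (pos_part_le0 z0) ger0_norm; nra.
- rewrite !pos_part_ge0//.
  have -> : (y + h) ^+ 2 - y ^+ 2 - 2 * y * h = h ^+ 2 by ring.
  by rewrite ger0_norm ?sqr_ge0// mul1r.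
Qed.

Lemma continuous_pos_part : continuous pos_part.
Proof.
move=> y; apply: cvgM; last exact: cvg_cst.
by apply: cvgD; [exact: cvg_id|apply: cvg_norm; exact: cvg_id].
Qed.

(** For c < d, a C^1 function supported in [c, d], with values in [0, 1], which
    increases with n to the indicator of the open interval. *)
Definition bump c d (n : nat) x : R :=
  1 - (1 + n%:R * pos_part ((x - c) * (d - x)) ^+ 2)^-1.

Lemma bump_den_gt0 c d n x :
  0 < 1 + n%:R * pos_part ((x - c) * (d - x)) ^+ 2.
Proof. by rewrite ltr_pwDl// mulr_ge0 ?sqr_ge0. Qed.

Lemma is_derive_bump c d n x : is_derive x 1 (bump c d n)
  ((1 + n%:R * pos_part ((x - c) * (d - x)) ^+ 2) ^- 2 *
   (n%:R * (2 * pos_part ((x - c) * (d - x)) * (c + d - 2 * x)))).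
Proof.
have dq : is_derive x 1 (fun x => (x - c) * (d - x)) (c + d - 2 * x).
  by apply: is_derive_eq; rewrite /GRing.scale/=; ring.
have db := @is_derive1_comp _ _ _ x _ _ (is_derive_pos_part_sqr _) dq.
have dD : is_derive x 1 (fun x => 1 + n%:R * pos_part ((x - c) * (d - x)) ^+ 2)
    (n%:R * (2 * pos_part ((x - c) * (d - x)) * (c + d - 2 * x))).
  have := is_deriveD (is_derive_cst (1 : R) x 1) (is_deriveZ n%:R db).
  by rewrite add0r.
have n0 := lt0r_neq0 (bump_den_gt0 c d n x).
have := is_deriveB (is_derive_cst (1 : R) x 1) (@is_deriveV _
  (fun x => 1 + n%:R * pos_part ((x - c) * (d - x)) ^+ 2) x _ _ n0 dD).
by rewrite sub0r scaleNr opprK.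
Qed.

Lemma bump_ge0_le1 c d n x : 0 <= bump c d n x <= 1.
Proof.
have := bump_den_gt0 c d n x; rewrite /bump.
have : 1 <= 1 + n%:R * pos_part ((x - c) * (d - x)) ^+ 2.
  by rewrite lerDl mulr_ge0 ?sqr_ge0.
move: (1 + _) => t t1 t0.
by rewrite subr_ge0 invf_le1// t1 gerBl invr_ge0 ltW.
Qed.

Lemma bump_base_gt0 c d x : c < d -> 0 < (x - c) * (d - x) -> c < x < d.
Proof.
move=> cd h; apply/andP; split; rewrite ltNge; apply/negP => xc; nra.
Qed.

Lemma C1c_bump L c d n : 0 < c -> c < d -> d < L -> C1c L (bump c d n).
Proof.
move=> c0 cd dL; split.
- by move=> x; have [] := is_derive_bump c d n x.
- have -> : derive1 (bump c d n) = fun x =>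
    (1 + n%:R * pos_part ((x - c) * (d - x)) ^+ 2) ^- 2 *
   (n%:R * (2 * pos_part ((x - c) * (d - x)) * (c + d - 2 * x))).
    by apply/funext => x; rewrite derive1E; have [] := is_derive_bump c d n x.
  have cq : continuous (fun x => pos_part ((x - c) * (d - x))).
    move=> x; apply: (@continuous_comp _ _ _ (fun x => (x - c) * (d - x)));
      last exact: continuous_pos_part.
    by apply: cvgM; apply: cvgB => //; exact: cvg_cst.
  move=> x; apply: cvgM.
    apply: cvgV; first by rewrite sqrf_eq0 lt0r_neq0// bump_den_gt0.
    apply: cvgM; (apply: cvgD; first exact: cvg_cst); apply: cvgMr;
      apply: cvgM; exact: cq.
  apply: cvgMr; apply: cvgM; first by apply: cvgMr; exact: cq.
  by apply: cvgB; [exact: cvg_cst|apply: cvgMr; exact: cvg_id].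
- exists c, d; split=> // x xcd.
  rewrite /bump pos_part_le0; last first.
    rewrite leNgt; apply/negP => h; apply: xcd.
    by have /andP[/ltW -> /ltW ->] := bump_base_gt0 cd h.
  by rewrite expr0n/= mulr0 addr0 invr1 subrr.
Qed.

Lemma cvg_bump c d x : c < d ->
  bump c d n x @[n --> \oo] --> (\1_(`]c, d[%classic) x : R).
Proof.
move=> cd; rewrite indicE; case: (boolP (x \in _)) => xcd /=.
  have q0 : 0 < (x - c) * (d - x).
    move: xcd; rewrite inE/= in_itv/= => /andP[cx xd].
    by rewrite mulr_gt0// subr_gt0.
  rewrite -[X in _ --> X]subr0; apply: cvgB; first exact: cvg_cst.
  rewrite pos_part_ge0 ?ltW//.
  set q := (_ * _) in q0 *; have q20 : 0 < q ^+ 2 by rewrite exprn_gt0.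
  apply/cvgr0Pnorm_lt => e e0; near=> n.
  have t0 : 0 < 1 + n%:R * q ^+ 2 by rewrite ltr_pwDl// mulr_ge0// ltW.
  rewrite gtr0_norm ?invr_gt0// invf_plt ?posrE//.
  rewrite ltr_pwDl// -ler_pdivrMr//.
  near: n; exact: nbhs_infty_ger.
have q0 : (x - c) * (d - x) <= 0.
  rewrite leNgt; apply: contraNN xcd => h; rewrite inE /= in_itv /=; exact: bump_base_gt0.
rewrite /bump pos_part_le0//; under eq_fun do rewrite expr0n/= mulr0 addr0 invr1 subrr.
exact: cvg_cst.
Unshelve. all: by end_near. Qed.

End SquareBump.

(** * The fundamental lemma of the calculus of variations *)

Section FundamentalLemma.
Variables (R : realType) (L : R).
Local Notation mu := (@lebesgue_measure R).
Local Notation I := (`]0, L[%classic : set R).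

Lemma C1c_continuous phi : C1c L phi -> continuous phi.
Proof.
move=> [dphi _ _] x; apply: differentiable_continuous.
by apply/derivable1_diffP; exact: dphi.
Qed.

Lemma C1c_ends phi : C1c L phi -> phi 0 = 0 /\ phi L = 0.
Proof.
move=> [_ _ [c [d [c0 dL h]]]]; split; apply: h => /andP[]; lra.
Qed.

(** Bump functions approximate the indicator of a subinterval. *)
Lemma integral_test_itv (w : R -> R) (c d : R) : 0 < c -> c < d -> d < L ->
  mu.-integrable I (EFin \o w) ->
  (forall phi, C1c L phi -> \int[mu]_(x in I) (w x * phi x) = 0) ->
  \int[mu]_(x in `]c, d[) w x = 0.
Proof.
move=> c0 cd dL iw hw.
have mw : measurable_fun I w.
  by move/integrableP : iw => [/measurable_EFinP].
have mI : measurable I by [].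
have cv := @Rintegral_dominated_cvg R I (fun n x => w x * bump c d n x)
  (fun x => w x * \1_(`]c, d[%classic) x) (fun x => `|w x|).
have : (\int[mu]_(x in I) (w x * bump c d n x)) @[n --> \oo] -->
    \int[mu]_(x in I) (w x * \1_(`]c, d[%classic) x).
  apply: cv => //.
  - move=> n; apply: measurable_funM => //; apply: measurable_funTS.
    apply: continuous_measurable_fun; apply: (@C1c_continuous (bump c d n)).
    exact: C1c_bump.
  - by move=> x _; apply: cvgMr; exact: cvg_bump.
  - exact: (integrable_norm iw).
  - move=> n x _; rewrite normrM ler_piMr//.
    by have /andP[b0 b1] := bump_ge0_le1 c d n x; rewrite ger0_norm.
have -> : (fun n => \int[mu]_(x in I) (w x * bump c d n x)) = cst 0.
  by apply/funext => n; rewrite hw//; exact: C1c_bump.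
move=> /(cvg_lim (@Rhausdorff R)); rewrite lim_cst// => ->.
have IE : I `&` `]c, d[ = `]c, d[%classic.
  apply/setIidPr => x /=; rewrite !in_itv/= => /andP[cx xd].
  by rewrite (lt_trans c0)//= (lt_trans xd).
rewrite -[in LHS]IE Rintegral_mkcondr; apply: eq_Rintegral => x _.
by rewrite patchE indicE; case: ifP => _; rewrite ?mulr1 ?mulr0.
Qed.

(** The primitive of w is constant on ]0, L[ by integral_test_itv, and it has
    derivative w almost everywhere. *)
Lemma fundamental_lemma (w : R -> R) : mu.-integrable I (EFin \o w) ->
  (forall phi, C1c L phi -> \int[mu]_(x in I) (w x * phi x) = 0) ->
  ae_eq mu I w (cst 0).
Proof.
move=> iw hw; pose f := w \_ I.
have mI : measurable I by [].
have iwT : mu.-integrable setT (EFin \o f).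
  rewrite /f -restrict_EFin; exact/(integrable_mkcond _ _).1.
have lf : locally_integrable setT f by exact: integrable_locally.
have iS (i : interval R) : mu.-integrable [set` i] (EFin \o f).
  by apply: integrableS iwT.
have := FTC1Ny (fun y => iS _) lf.
apply: filterS; first exact: (ae_filter_ringOfSetsType mu).
move=> x [_ dF] xI.
transitivity (f x); first by rewrite /f patchE mem_set.
rewrite -dF; set F := fun y : R => _.
have xI' : 0 < x < L by move: xI; rewrite /= in_itv.
have Fle y z : 0 < y -> y < z -> z < L -> F z = F y.
  move=> y0 yz zL; apply/eqP; rewrite -subr_eq0; apply/eqP.
  rewrite /F Rintegral_itvB//; [|by rewrite bnd_simp ltW].
  rewrite -Rintegral_itv_bndo_bndc//.
  transitivity (\int[mu]_(t in `]y, z[) w t); last exact: integral_test_itv.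
  apply: eq_Rintegral => t; rewrite inE/= in_itv/= => /andP[yt tz].
  rewrite /f patchE mem_set//= in_itv/= (lt_trans y0)//=.
  exact: lt_trans zL.
have cF : \forall y \near x, F y = cst (F x) y.
  have [x0 xL] := andP xI'.
  near=> y; have y0 : 0 < y by near: y; exact: lt_nbhsr.
  have yL : y < L by near: y; exact: lt_nbhsl.
  have [yx|xy|->//] := ltgtP y x.
    by rewrite /= (Fle y x).
  by rewrite /= (Fle x y).
by rewrite derive1E (near_eq_derive _ cF) derive_cst.
Unshelve. all: by end_near. Qed.

End FundamentalLemma.

(** * Square-integrable complex functions and real weak derivatives *)

Section Components.
Variable R : realType.
Local Notation mu := (@lebesgue_measure R).
Local Notation Re := complex.Re.
Local Notation Im := complex.Im.
Implicit Types (D : set R) (f g : R -> R[i]) (c : R[i]).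

Lemma eq_ReIm (x y : R[i]) : Re x = Re y -> Im x = Im y -> x = y.
Proof. by move=> xy1 xy2; apply/eqP; rewrite eq_complex xy1 xy2 !eqxx. Qed.

Lemma Re_lin c (x y : R[i]) :
  Re (c * x + y) = Re c * Re x + (- Im c * Im x + Re y).
Proof. by case: c x y => [? ?] [? ?] [? ?] /=; ring. Qed.

Lemma Im_lin c (x y : R[i]) :
  Im (c * x + y) = Re c * Im x + (Im c * Re x + Im y).
Proof. by case: c x y => [? ?] [? ?] [? ?] /=; ring. Qed.

Lemma L2P D f : measurable D ->
  L2 D f <-> L2r D (fun x => Re (f x)) /\ L2r D (fun x => Im (f x)).
Proof.
move=> mD; split=> [[mr mi ii]|[[mr ir] [mi ii]]]; last first.
  by split=> //; exact: integrableDr.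
split; split=> //; apply: integrable_dominated ii => //.
- exact: measurable_funX.
- by move=> x _; rewrite ger0_norm ?sqr_ge0// lerDl sqr_ge0.
- exact: measurable_funX.
- by move=> x _; rewrite ger0_norm ?sqr_ge0// lerDr sqr_ge0.
Qed.

Lemma L2_lin D c f g : measurable D -> L2 D f -> L2 D g -> 
  L2 D (fun x => c * f x + g x).
Proof.
move=> mD /(L2P _ mD)[fr fi] /(L2P _ mD)[gr gi]; apply/(L2P _ mD).
split.
  under eq_fun do rewrite Re_lin.
  by do 2 apply: L2r_lin => //.
under eq_fun do rewrite Im_lin.
by do 2 apply: L2r_lin => //.
Qed.

Lemma ae_eqP D f g : ae_eq mu D f g <->
  ae_eq mu D (fun x => Re (f x)) (fun x => Re (g x)) /\
  ae_eq mu D (fun x => Im (f x)) (fun x => Im (g x)).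
Proof.
split=> [fg|[fgr fgi]].
  by split; apply: filterS fg => x fgx Dx; rewrite fgx.
by apply: filterS2 fgr fgi => x r i Dx; apply: eq_ReIm; [exact: r|exact: i].
Qed.

Lemma L2_0 D : measurable D -> L2 D (cst (0 : R[i])).
Proof.
move=> mD; split; [exact: measurable_cst|exact: measurable_cst|].
apply: (eq_integrable _ _ _ _ (integrable0 mu D)) => // x _ /=.
by rewrite expr0n addr0.
Qed.

End Components.

Section WeakDerivative.
Variables (R : realType) (L : R).
Local Notation mu := (@lebesgue_measure R).
Local Notation Re := complex.Re.
Local Notation Im := complex.Im.
Local Notation I := (`]0, L[%classic : set R).
Implicit Types (u r s : R -> R) (v w : R -> R[i]).

(** r is the weak derivative of the real function u. *)
Definition rwderiv u r : Prop := forall phi, C1c L phi ->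
  \int[mu]_(x in I) (u x * derive1 phi x) = - \int[mu]_(x in I) (r x * phi x).

Lemma is_wderivP v w : is_wderiv L v w <->
  rwderiv (fun x => Re (v x)) (fun x => Re (w x)) /\
  rwderiv (fun x => Im (v x)) (fun x => Im (w x)).
Proof.
have reE (f : R -> R[i]) (g : R -> R) :
    (fun x => Re (f x * (g x)%:C)) = (fun x => Re (f x) * g x).
  by apply/funext => x; case: (f x) => a b /=; rewrite mulr0 subr0.
have imE (f : R -> R[i]) (g : R -> R) :
    (fun x => Im (f x * (g x)%:C)) = (fun x => Im (f x) * g x).
  by apply/funext => x; case: (f x) => a b /=; rewrite mulr0 add0r.
rewrite /is_wderiv /cint; split=> [h|[hr hi] phi hphi].
  by split=> phi /h; rewrite !reE !imE => -[].
by rewrite !reE !imE hr// hi.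
Qed.

Lemma C1c_L2r phi : C1c L phi -> L2r I phi /\ L2r I (derive1 phi).
Proof.
move=> hphi; split; apply: continuous_L2r; first exact: C1c_continuous hphi.
by case: hphi.
Qed.

Lemma rwderiv_unique u r s : L2r I r -> L2r I s ->
  rwderiv u r -> rwderiv u s -> ae_eq mu I r s.
Proof.
move=> Lr Ls hr hs.
have mI : measurable I by [].
have Lrs : L2r I (fun x => -1 * s x + r x) by exact: L2r_lin.
have : ae_eq mu I (fun x => -1 * s x + r x) (cst 0).
  apply: fundamental_lemma; first exact: L2r_integrable.
  move=> phi hphi; have [Lphi _] := C1c_L2r hphi.
  transitivity (\int[mu]_(x in I) (r x * phi x - s x * phi x)).
    by apply: eq_Rintegral => x _; ring.
  rewrite RintegralB//; [|exact: L2rM|exact: L2rM].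
  by rewrite -[X in X - _]opprK -hr// hs// opprK subrr.
by apply: filterS => x h /h; rewrite mulN1r addrC => /eqP; rewrite subr_eq0 => /eqP.
Qed.

Lemma rwderiv_lin u r u' s (k : R) : L2r I u -> L2r I r -> L2r I u' -> L2r I s ->
  rwderiv u r -> rwderiv u' s ->
  rwderiv (fun x => k * u x + u' x) (fun x => k * r x + s x).
Proof.
move=> Lu Lr Lv Ls hr hs phi hphi.
have mI : measurable I by [].
have [Lphi Ldphi] := C1c_L2r hphi.
have lin (f g h : R -> R) : L2r I f -> L2r I g -> L2r I h ->
    \int[mu]_(x in I) ((k * f x + g x) * h x) =
    k * \int[mu]_(x in I) (f x * h x) + \int[mu]_(x in I) (g x * h x).
  move=> Lf Lg Lh.
  rewrite -RintegralZl//; last exact: L2rM.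
  rewrite -RintegralD//; [|by apply: integrableZr => //; exact: L2rM|exact: L2rM].
  by apply: eq_Rintegral => x _; ring.
by rewrite !lin// hr// hs//; ring.
Qed.

Lemma rwderiv_ae u u' r r' : measurable_fun I u -> measurable_fun I u' ->
  measurable_fun I r -> measurable_fun I r' ->
  ae_eq mu I u u' -> ae_eq mu I r r' -> rwderiv u r -> rwderiv u' r'.
Proof.
move=> mu_ mu' mr mr' uu' rr' h phi hphi.
have [[mphi _] [mdphi _]] := C1c_L2r hphi.
have E (f g t : R -> R) : measurable_fun I f -> measurable_fun I g -> measurable_fun I t ->
    ae_eq mu I f g ->
    \int[mu]_(x in I) (f x * t x) = \int[mu]_(x in I) (g x * t x).
  move=> mf mg mt fg; congr fine; apply: ae_eq_integral => //.
  - by apply/measurable_EFinP; exact: measurable_funM.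
  - by apply/measurable_EFinP; exact: measurable_funM.
  by apply: filterS fg => x fgx Dx; rewrite fgx.
by rewrite -(E u)// h// (E r r').
Qed.

(** A classical derivative is a weak derivative, by integration by parts. *)
Lemma rwderiv_classical u r : 0 < L -> (forall x : R, is_derive x 1 u (r x)) ->
  continuous r -> rwderiv u r.
Proof.
move=> L0 du cr phi hphi.
have cphi := C1c_continuous hphi.
have [dphi cdphi _] := hphi.
have [phi0 phiL] := C1c_ends hphi.
have cu : continuous u.
  move=> x; apply: differentiable_continuous; apply/derivable1_diffP.
  by have [] := du x.
have oc (f g : R -> R) : continuous f -> continuous g ->
    \int[mu]_(x in I) (f x * g x) = \int[mu]_(x in `[0, L]) (f x * g x).
  move=> cf cg; have cfg : continuous (fun x => f x * g x).
    by move=> x; apply: cvgM; [exact: cf|exact: cg].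
  rewrite Rintegral_itv_bndo_bndc ?Rintegral_itv_obnd_cbnd//.
  - apply: (@integrableS _ _ _ mu `[0, L]%classic) => //.
      exact: subset_itv_oc_cc.
    apply: continuous_compact_integrable; first exact: segment_compact.
    exact: continuous_subspaceT.
  - exact: continuous_integrable_itv.
rewrite !oc//.
have du' : derivable_oo_LRcontinuous u 0 L.
  split; first by move=> x _; have [] := du x.
    by apply: cvg_at_right_filter; exact: cu.
  by apply: cvg_at_left_filter; exact: cu.
have dphi' : derivable_oo_LRcontinuous phi 0 L.
  split; first by move=> x _; exact: dphi.
    by apply: cvg_at_right_filter; exact: cphi.
  by apply: cvg_at_left_filter; exact: cphi.
have uE : {in `]0, L[, derive1 u =1 r}.
  by move=> x _; rewrite derive1E; have [] := du x.
rewrite (Rintegration_by_parts L0 (continuous_subspaceT cr) du' uE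
  (continuous_subspaceT cdphi) dphi' (fun x _ => erefl)).
by rewrite phi0 phiL !mulr0 subrr sub0r.
Qed.

End WeakDerivative.

(** * Weak derivatives, traces and classical functions *)

Section Sobolev1.
Variables (R : realType) (L : R).
Hypothesis L_gt0 : 0 < L.
Local Notation mu := (@lebesgue_measure R).
Local Notation Re := complex.Re.
Local Notation Im := complex.Im.
Local Notation I := (`]0, L[%classic : set R).
Implicit Types (v w h : R -> R[i]) (c : R[i]).

Let mI : measurable I. Proof. by []. Qed.

Lemma is_wderiv_unique v w w' : L2 I w -> L2 I w' ->
  is_wderiv L v w -> is_wderiv L v w' -> ae_eq mu I w w'.
Proof.
move=> /(L2P _ mI)[Lr Li] /(L2P _ mI)[Lr' Li'].
move=> /is_wderivP[dr di] /is_wderivP[dr' di']; apply/ae_eqP.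
by split; [exact: rwderiv_unique dr dr'|exact: rwderiv_unique di di'].
Qed.

Lemma Re_linE c v w : (fun x => Re (c * v x + w x)) =
  (fun x => Re c * Re (v x) + (- Im c * Im (v x) + Re (w x))).
Proof. by apply/funext => x; rewrite Re_lin. Qed.

Lemma Im_linE c v w : (fun x => Im (c * v x + w x)) =
  (fun x => Re c * Im (v x) + (Im c * Re (v x) + Im (w x))).
Proof. by apply/funext => x; rewrite Im_lin. Qed.

Lemma is_wderiv_lin c v w v' w' : L2 I v -> L2 I w -> L2 I v' -> L2 I w' ->
  is_wderiv L v w -> is_wderiv L v' w' ->
  is_wderiv L (fun x => c * v x + v' x) (fun x => c * w x + w' x).
Proof.
move=> /(L2P _ mI)[? ?] /(L2P _ mI)[? ?] /(L2P _ mI)[? ?] /(L2P _ mI)[? ?].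
move=> /is_wderivP[? ?] /is_wderivP[? ?]; apply/is_wderivP.
rewrite !Re_linE !Im_linE; split.
  have A := @rwderiv_lin R L (fun x => Im (v x)) (fun x => Im (w x))
    (fun x => Re (v' x)) (fun x => Re (w' x)) (- Im c).
  apply: rwderiv_lin; [by []|by []|exact: L2r_lin|exact: L2r_lin|by []|exact: A].
have A := @rwderiv_lin R L (fun x => Re (v x)) (fun x => Re (w x))
  (fun x => Im (v' x)) (fun x => Im (w' x)) (Im c).
apply: rwderiv_lin; [by []|by []|exact: L2r_lin|exact: L2r_lin|by []|exact: A].
Qed.

Lemma is_wderiv_ae v v' w w' : L2 I v -> L2 I v' -> L2 I w -> L2 I w' ->
  ae_eq mu I v v' -> ae_eq mu I w w' -> is_wderiv L v w -> is_wderiv L v' w'.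
Proof.
move=> [? ? _] [? ? _] [? ? _] [? ? _] /ae_eqP[vr vi] /ae_eqP[wr wi].
move=> /is_wderivP[? ?]; apply/is_wderivP.
by split; [apply: rwderiv_ae vr wr _|apply: rwderiv_ae vi wi _].
Qed.

Lemma wderivP v : H1 L v -> L2 I (wderiv L v) /\ is_wderiv L v (wderiv L v).
Proof.
move=> [_ [w Lw dw]]; rewrite /wderiv.
by apply: (@xgetPex _ (cst 0) [set w | L2 `]0, L[ w /\ is_wderiv L v w]); exists w.
Qed.

Lemma wderiv_eq v w : L2 I v -> L2 I w -> is_wderiv L v w ->
  ae_eq mu I (wderiv L v) w.
Proof.
move=> Lv Lw dw; have [L' d'] : L2 I (wderiv L v) /\ is_wderiv L v (wderiv L v).
  by apply: wderivP; split=> //; exists w.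
exact: is_wderiv_unique d' dw.
Qed.

Lemma H1_lin c v v' : H1 L v -> H1 L v' -> H1 L (fun x => c * v x + v' x).
Proof.
move=> hv hv'; have [Lw dw] := wderivP hv; have [Lw' dw'] := wderivP hv'.
case: hv hv' => [Lv _] [Lv' _]; split; first exact: L2_lin.
exists (fun x => c * wderiv L v x + wderiv L v' x); first exact: L2_lin.
exact: is_wderiv_lin.
Qed.

Lemma wderiv_ae v v' : H1 L v -> H1 L v' -> ae_eq mu I v v' ->
  ae_eq mu I (wderiv L v) (wderiv L v').
Proof.
move=> hv hv' vv'; have [Lw dw] := wderivP hv; have [Lw' dw'] := wderivP hv'.
have [[Lv _] [Lv' _]] := (hv, hv').
apply: (wderiv_eq Lv Lw').
apply: (is_wderiv_ae Lv' Lv Lw' Lw') dw'; first exact: ae_eq_sym.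
exact: ae_eq_refl.
Qed.

(** The end points of [0, L] are included. *)
Lemma continuous_ae_eq (u r : R -> R) x : {within `[0, L], continuous u} ->
  {within `[0, L], continuous r} -> ae_eq mu I u r -> 0 <= x <= L -> u x = r x.
Proof.
move=> cu cr [A [mA A0 hA]] xL; apply/eqP; apply/negPn/negP => ur.
have ur0 : 0 < `|u x - r x| by rewrite normr_gt0 subr_eq0.
have : \forall y \near x, `[0, L]%classic y -> u y != r y.
  have cc : {within `[0, L], continuous (u - r)}.
    by move=> y; apply: cvgB; [exact: cu|exact: cr].
  have xI : `[0, L]%classic x by rewrite /= in_itv.
  move/subspace_continuousP/(_ x xI)/cvgrPdist_lt/(_ _ ur0): cc.
  apply: filterS => y h; apply/eqP => e.
  have {}h : `|(u x - r x) - (u y - r y)| < `|u x - r x| by exact: h.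
  by move: h; rewrite e subrr subr0 ltxx.
move=> [e /= e0 he].
have [x0 xL'] := andP xL.
pose c := Num.max 0 (x - e); pose d := Num.min L (x + e).
have cd : c < d.
  rewrite /c /d gt_max !lt_min L_gt0 /=; apply/and3P; split; lra.
have JA : `]c, d[%classic `<=` A.
  move=> y; rewrite /= in_itv/= /c /d gt_max lt_min => /andP[/andP[y0 ye] /andP[yL ye']].
  apply: hA => /= h.
  have yI : I y by rewrite /= in_itv/= y0.
  have : u y != r y.
    apply: he; last by rewrite /= in_itv/= !ltW.
    by rewrite /= ltr_distl; lra.
  by rewrite (h yI) eqxx.
have : (mu `]c, d[%classic <= mu A)%E.
  by apply: le_measure => //; rewrite inE.
rewrite A0 lebesgue_measure_itv/= lte_fin cd -EFinB lee_fin; lra.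
Qed.

(** h is a continuous representative of v on [0, L]. *)
Definition cont_rep h v : Prop :=
  [/\ {within `[0, L], continuous (fun x => Re (h x))},
      {within `[0, L], continuous (fun x => Im (h x))} & ae_eq mu I h v].

Lemma crepE h v x : cont_rep h v -> 0 <= x <= L -> crep L v x = h x.
Proof.
move=> hh xL; have [cr ci hv] := hh.
have [cr' ci' hv'] : cont_rep (crep L v) v.
  by apply: (@xgetPex _ (cst 0) [set h | cont_rep h v]); exists h.
have /ae_eqP[er ei] := ae_eq_trans hv' (ae_eq_sym hv).
apply: eq_ReIm.
  exact: (continuous_ae_eq cr' cr er).
exact: (continuous_ae_eq ci' ci ei).
Qed.

(** In the absence of a continuous representative all traces are 0. *)
Lemma crep_none v : ~ (exists h, cont_rep h v) -> crep L v = cst 0.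
Proof.
move=> nh; rewrite /crep; case: xgetP => // h _ hh.
by exfalso; apply: nh; exists h.
Qed.

Lemma cont_rep_lin c h v h' v' : cont_rep h v -> cont_rep h' v' ->
  cont_rep (fun x => c * h x + h' x) (fun x => c * v x + v' x).
Proof.
move=> [hr hi hv] [hr' hi' hv'].
have lin (a b : R) (f g k : R -> R) : {within `[0, L], continuous f} ->
    {within `[0, L], continuous g} -> {within `[0, L], continuous k} ->
    {within `[0, L], continuous (fun x => a * f x + (b * g x + k x))}.
  move=> cf cg ck x; apply: cvgD; first by apply: cvgMr; exact: cf.
  by apply: cvgD; [apply: cvgMr; exact: cg|exact: ck].
split.
- by rewrite Re_linE; exact: lin.
- by rewrite Im_linE; exact: lin.
by apply: filterS2 hv hv' => x e e' Dx; rewrite e// e'.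
Qed.

Let zero_in : 0 <= (0 : R) <= L. Proof. by rewrite lexx ltW. Qed.

(** v is a classical C^1 function with derivative w. *)
Definition smooth v w : Prop :=
  [/\ forall x : R, is_derive x 1 (fun x => Re (v x)) (Re (w x)),
      forall x : R, is_derive x 1 (fun x => Im (v x)) (Im (w x)),
      continuous (fun x => Re (w x)) & continuous (fun x => Im (w x))].

Lemma is_derive_continuous (u r : R -> R) :
  (forall x : R, is_derive x 1 u (r x)) -> continuous u.
Proof.
move=> du x; apply: differentiable_continuous; apply/derivable1_diffP.
by have [] := du x.
Qed.

Lemma continuous_L2 v : continuous (fun x => Re (v x)) ->
  continuous (fun x => Im (v x)) -> L2 I v.
Proof. by move=> cr ci; apply/(L2P _ mI); split; exact: continuous_L2r. Qed.

Lemma continuous_cont_rep v : continuous (fun x => Re (v x)) ->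
  continuous (fun x => Im (v x)) -> cont_rep v v.
Proof.
move=> cr ci; split; [exact: continuous_subspaceT..|].
exact: ae_eq_refl.
Qed.

Lemma smooth_L2 v w : smooth v w -> L2 I v /\ L2 I w.
Proof.
move=> [dr di cr ci]; split; apply: continuous_L2 => //.
  exact: is_derive_continuous dr.
exact: is_derive_continuous di.
Qed.

Lemma smooth_wderiv v w : smooth v w -> is_wderiv L v w.
Proof. by move=> [dr di cr ci]; apply/is_wderivP; split; exact: rwderiv_classical. Qed.

Lemma smooth_H1 v w : smooth v w -> H1 L v.
Proof.
move=> vw; have [Lv Lw] := smooth_L2 vw.
by split=> //; exists w => //; exact: smooth_wderiv.
Qed.

Lemma smooth_wderiv_ae v w : smooth v w -> ae_eq mu I (wderiv L v) w.
Proof.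
by move=> vw; have [Lv Lw] := smooth_L2 vw; apply: wderiv_eq => //; exact: smooth_wderiv.
Qed.

Lemma smooth_cont_rep v w : smooth v w -> cont_rep v v.
Proof.
move=> [dr di cr ci]; apply: continuous_cont_rep.
  exact: is_derive_continuous dr.
exact: is_derive_continuous di.
Qed.

Lemma smooth_crep v w x : smooth v w -> 0 <= x <= L -> crep L v x = v x.
Proof. by move=> /smooth_cont_rep; exact: crepE. Qed.

Lemma smooth_H1s v w : smooth v w -> v 0 = 0 -> H1s L v.
Proof. by move=> vw v0; split; [exact: smooth_H1 vw|rewrite (smooth_crep vw)]. Qed.

Lemma smooth_crep_wderiv v w w' x : smooth v w -> smooth w w' -> 0 <= x <= L ->
  crep L (wderiv L v) x = w x.
Proof.
move=> vw ww'; apply: crepE; have [c1 c2 _] := smooth_cont_rep ww'.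
by split=> //; apply: ae_eq_sym; exact: smooth_wderiv_ae.
Qed.

Lemma smooth_wderiv2 v w w' : smooth v w -> smooth w w' ->
  H1 L (wderiv L v) /\ ae_eq mu I (wderiv L (wderiv L v)) w'.
Proof.
move=> vw ww'; have [Lv Lw] := smooth_L2 vw; have [_ Lw'] := smooth_L2 ww'.
have [Ld dd] := wderivP (smooth_H1 vw).
have e := smooth_wderiv_ae vw.
have d2 : is_wderiv L (wderiv L v) w'.
  apply: (is_wderiv_ae Lw Ld Lw' Lw' _ _ (smooth_wderiv ww')).
    exact: ae_eq_sym.
  exact: ae_eq_refl.
by split; [split=> //; exists w'|exact: wderiv_eq].
Qed.

Lemma smooth_0 : smooth (cst 0) (cst 0).
Proof.
by split; [move=> x; exact: is_derive_cst|move=> x; exact: is_derive_cst|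
  move=> x; exact: cvg_cst|move=> x; exact: cvg_cst].
Qed.

Lemma H1s_0 : H1s L (cst 0).
Proof. by apply: (smooth_H1s smooth_0). Qed.

Lemma H1s_scale c v : H1s L v -> H1s L (fun x => c * v x).
Proof.
move=> [hv v0].
have E : (fun x => c * v x) = (fun x => c * v x + (cst 0 : R -> R[i]) x).
  by apply/funext => x; rewrite addr0.
split; first by rewrite E; apply: H1_lin => //; by have [] := H1s_0.
have [[h hh]|nh] := pselect (exists h, cont_rep h (fun x => c * v x)); last first.
  by rewrite crep_none.
have [c0|c0] := eqVneq c 0.
  have -> : (fun x => c * v x) = cst 0 by apply/funext => x; rewrite c0 mul0r.
  by have [] := H1s_0.
have hv' : cont_rep (fun x => c^-1 * h x) v.
  have z : cont_rep (cst 0) (cst 0).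
    split; [by move=> x; exact: cvg_cst|by move=> x; exact: cvg_cst|].
    exact: ae_eq_refl.
  have := cont_rep_lin c^-1 hh z.
  congr cont_rep; apply/funext => x /=; first by rewrite addr0.
  by rewrite addr0 mulKf.
rewrite (crepE hh)//; move: v0; rewrite (crepE hv')// => /eqP.
by rewrite mulf_eq0 invr_eq0 (negbTE c0)/= => /eqP.
Qed.

(** The trace at 0 is additive as soon as one summand has a continuous
    representative: if the other one has none, nor has the sum. *)
Lemma H1s_addl c v w h : H1s L v -> H1s L w -> cont_rep h w ->
  H1s L (fun x => c * w x + v x).
Proof.
move=> [hv v0] [hw w0] hh; split; first exact: H1_lin.
have [[k hk]|nk] := pselect (exists k, cont_rep k v).
  have := crepE (cont_rep_lin c hh hk) zero_in.
  rewrite -(crepE hh zero_in) -(crepE hk zero_in) v0 w0 mulr0 addr0; exact.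
rewrite crep_none// => -[k hk]; apply: nk.
exists (fun x => (- c) * h x + k x).
have [c1 c2 c3] := cont_rep_lin (- c) hh hk; split=> //.
by apply: filterS c3 => x e Dx; rewrite e// mulNr addKr.
Qed.

End Sobolev1.

(** * The norm of the energy space *)

Section SquareNorm.
Variable R : realType.
Local Notation mu := (@lebesgue_measure R).
Local Notation Re := complex.Re.
Local Notation Im := complex.Im.
Implicit Types (D : set R) (f g : R -> R[i]) (c : R[i]).

(** The squared modulus. *)
Definition sqc (z : R[i]) : R := Re z ^+ 2 + Im z ^+ 2.

Lemma sqc_ge0 z : 0 <= sqc z.
Proof. by rewrite addr_ge0 ?sqr_ge0. Qed.

Lemma sqcM z t : sqc (z * t) = sqc z * sqc t.
Proof. by case: z t => [? ?] [? ?]; rewrite /sqc /=; ring. Qed.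

Lemma sqcE z : sqc z = normc z ^+ 2.
Proof. by case: z => x y; rewrite /normc sqr_sqrtr// addr_ge0 ?sqr_ge0. Qed.

(** This form of the triangle inequality is linear in the squared moduli, hence
    can be integrated; sqrt_triangle optimises over e afterwards. *)
Lemma sqcD e z t : 0 < e -> sqc (z + t) <= (1 + e) * sqc z + (1 + e^-1) * sqc t.
Proof.
move=> e0; have D (x y : R) :
    (x + y) ^+ 2 <= (1 + e) * x ^+ 2 + (1 + e^-1) * y ^+ 2.
  rewrite -subr_ge0.
  have -> : (1 + e) * x ^+ 2 + (1 + e^-1) * y ^+ 2 - (x + y) ^+ 2 =
      e^-1 * (e * x - y) ^+ 2 by field; rewrite gt_eqF.
  by rewrite mulr_ge0 ?sqr_ge0// invr_ge0 ltW.
case: z t => [x y] [x' y']; rewrite /sqc /=.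
by apply: (le_trans (lerD (D x x') (D y y'))); rewrite !mulrDr; lra.
Qed.

(** The squared L^2 norm on D. *)
Definition sqnorm D f : R := \int[mu]_(x in D) sqc (f x).

Lemma sqnorm_ge0 D f : 0 <= sqnorm D f.
Proof. by apply: Rintegral_ge0 => x _; exact: sqc_ge0. Qed.

Lemma L2_sqc_integrable D f : L2 D f -> mu.-integrable D (EFin \o (fun x => sqc (f x))).
Proof. by case. Qed.

Lemma sqnorm_ae D f g : measurable D -> L2 D f -> L2 D g -> ae_eq mu D f g ->
  sqnorm D f = sqnorm D g.
Proof.
move=> mD /L2_sqc_integrable/integrableP[mf _] /L2_sqc_integrable/integrableP[mg _] fg.
congr fine; apply: ae_eq_integral => //.
by apply: filterS fg => x h /h /= ->.
Qed.

Lemma sqnormZ D c f : measurable D -> L2 D f ->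
  sqnorm D (fun x => c * f x) = sqc c * sqnorm D f.
Proof.
move=> mD /L2_sqc_integrable Lf; rewrite -RintegralZl//.
by apply: eq_Rintegral => x _; rewrite sqcM.
Qed.

Lemma sqnormD D e f g : measurable D -> 0 < e -> L2 D f -> L2 D g ->
  sqnorm D (fun x => f x + g x) <=
  (1 + e) * sqnorm D f + (1 + e^-1) * sqnorm D g.
Proof.
move=> mD e0 Lf Lg.
have Lfg : L2 D (fun x => f x + g x).
  by under eq_fun do rewrite -[f _]mul1r; exact: L2_lin.
move/L2_sqc_integrable: (Lfg) => ifg.
move/L2_sqc_integrable: (Lf) => if_; move/L2_sqc_integrable: (Lg) => ig.
have i1 := integrableZr (1 + e) mD if_; have i2 := integrableZr (1 + e^-1) mD ig.
rewrite -RintegralZl// -RintegralZl// -RintegralD//.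
apply: le_Rintegral => //; first exact: integrableDr.
by move=> x _; exact: sqcD.
Qed.

End SquareNorm.

Lemma state_linE (R : realType) (c : R[i]) (V f p P g q V' f' p' P' g' q' : R -> R[i]) :
  c *: ((V, f, p, P, g, q) : state R) + (V', f', p', P', g', q') =
  (fun x => c * V x + V' x, fun x => c * f x + f' x, fun x => c * p x + p' x,
   fun x => c * P x + P' x, fun x => c * g x + g' x, fun x => c * q x + q' x).
Proof. reflexivity. Qed.

Lemma state_scaleE (R : realType) (c : R[i]) (V f p P g q : R -> R[i]) :
  c *: ((V, f, p, P, g, q) : state R) =
  (fun x => c * V x, fun x => c * f x, fun x => c * p x,
   fun x => c * P x, fun x => c * g x, fun x => c * q x).
Proof. reflexivity. Qed.

Section EnergyNorm.
Variable R : realType.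
Variables rho alpha1 beta gamma mu L l1 l2 a : R.
Hypotheses (rho_gt0 : 0 < rho) (alpha1_gt0 : 0 < alpha1) (beta_gt0 : 0 < beta).
Hypotheses (mu_gt0 : 0 < mu) (L_gt0 : 0 < L) (l1_gt0 : 0 < l1) (l2_gt0 : 0 < l2).
Hypotheses (a_gt0 : 0 < a) (a_lt1 : a < 1).
Local Notation lambda := (@lebesgue_measure R).
Local Notation Re := complex.Re.
Local Notation Im := complex.Im.
Local Notation I := (`]0, L[%classic : set R).
Local Notation nrm := (normH rho alpha1 beta gamma mu L l1 l2 a).
Local Notation kappa := (sin (a * pi) / pi).
Implicit Types (U W : state R) (c : R[i]).

Let mI : measurable I. Proof. by []. Qed.

Lemma kappa_gt0 : 0 < kappa.
Proof.
rewrite divr_gt0 ?pi_gt0// sin_gt0_pi// mulr_gt0 ?pi_gt0//=.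
by rewrite gtr_pMl ?pi_gt0.
Qed.

(** The space H without the boundary conditions at 0, which is closed under
    linear combinations. *)
Definition Hwide : set (state R) := [set U |
  let: (V, f, phi1, P, g, phi2) := U in
  [/\ H1 L V, L2 I f & L2 setT phi1] /\ [/\ H1 L P, L2 I g & L2 setT phi2]].

(** The squared norm of H as a function of f, g, V_x, gamma V_x - P_x, phi_1
    and phi_2. *)
Definition energy (f g p r phi1 phi2 : R -> R[i]) : R :=
  (rho * sqnorm I f + mu * sqnorm I g + alpha1 * sqnorm I p +
     beta * sqnorm I r) +
  kappa * (l1 * sqnorm setT phi1 + l2 * sqnorm setT phi2).

Lemma energy_ge0 f g p r phi1 phi2 : 0 <= energy f g p r phi1 phi2.
Proof.
rewrite /energy; move: kappa kappa_gt0 => k k0.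
by rewrite !(addr_ge0, mulr_ge0)// ?sqnorm_ge0 ?ltW.
Qed.

Lemma energy_ae f g p r phi1 phi2 f' g' p' r' phi1' phi2' :
  [/\ L2 I f, L2 I g & L2 I p] -> [/\ L2 I r, L2 setT phi1 & L2 setT phi2] ->
  [/\ L2 I f', L2 I g' & L2 I p'] -> [/\ L2 I r', L2 setT phi1' & L2 setT phi2'] ->
  [/\ ae_eq lambda I f f', ae_eq lambda I g g' & ae_eq lambda I p p'] ->
  [/\ ae_eq lambda I r r', ae_eq lambda setT phi1 phi1' & ae_eq lambda setT phi2 phi2'] ->
  energy f g p r phi1 phi2 = energy f' g' p' r' phi1' phi2'.
Proof.
move=> [? ? ?] [? ? ?] [? ? ?] [? ? ?] [? ? ?] [? ? ?].
have mT : measurable (setT : set R) by [].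
rewrite /energy (@sqnorm_ae _ I f f')// (@sqnorm_ae _ I g g')//.
rewrite (@sqnorm_ae _ I p p')// (@sqnorm_ae _ I r r')//.
by rewrite (@sqnorm_ae _ setT phi1 phi1')// (@sqnorm_ae _ setT phi2 phi2').
Qed.

Lemma energyZ c f g p r phi1 phi2 :
  [/\ L2 I f, L2 I g & L2 I p] -> [/\ L2 I r, L2 setT phi1 & L2 setT phi2] ->
  energy (fun x => c * f x) (fun x => c * g x) (fun x => c * p x)
    (fun x => c * r x) (fun x => c * phi1 x) (fun x => c * phi2 x) =
  sqc c * energy f g p r phi1 phi2.
Proof. by move=> [? ? ?] [? ? ?]; rewrite /energy !sqnormZ//; ring. Qed.

Lemma energyD e f g p r phi1 phi2 f' g' p' r' phi1' phi2' : 0 < e ->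
  [/\ L2 I f, L2 I g & L2 I p] -> [/\ L2 I r, L2 setT phi1 & L2 setT phi2] ->
  [/\ L2 I f', L2 I g' & L2 I p'] -> [/\ L2 I r', L2 setT phi1' & L2 setT phi2'] ->
  energy (fun x => f x + f' x) (fun x => g x + g' x) (fun x => p x + p' x)
    (fun x => r x + r' x) (fun x => phi1 x + phi1' x) (fun x => phi2 x + phi2' x) <=
  (1 + e) * energy f g p r phi1 phi2 +
  (1 + e^-1) * energy f' g' p' r' phi1' phi2'.
Proof.
move=> e0 [? ? ?] [? ? ?] [? ? ?] [? ? ?]; have k0 := kappa_gt0.
have mT : measurable (setT : set R) by [].
have D E k (h h' : R -> R[i]) : 0 < k -> measurable E -> L2 E h -> L2 E h' ->
    k * sqnorm E (fun x => h x + h' x) <=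
    (1 + e) * (k * sqnorm E h) + (1 + e^-1) * (k * sqnorm E h').
  move=> k1 mE Lh Lh'.
  by rewrite !(mulrCA _ k) -mulrDr ler_pM2l//; exact: sqnormD.
rewrite /energy !(mulrDr kappa) !(mulrA kappa).
have := D I rho f f' rho_gt0 mI; have := D I mu g g' mu_gt0 mI.
have := D I alpha1 p p' alpha1_gt0 mI; have := D I beta r r' beta_gt0 mI.
have := D setT (kappa * l1) phi1 phi1' (mulr_gt0 k0 l1_gt0) mT.
have := D setT (kappa * l2) phi2 phi2' (mulr_gt0 k0 l2_gt0) mT.
do 6 (move=> /(_ ltac:(assumption) ltac:(assumption)) ?).
lra.
Qed.

Lemma L2_scale D c f : measurable D -> L2 D f -> L2 D (fun x => c * f x).
Proof.
move=> mD Lf; have -> : (fun x => c * f x) = (fun x => (c - 1) * f x + f x).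
  by apply/funext => x; ring.
exact: L2_lin.
Qed.

Lemma L2_comb p q : L2 I p -> L2 I q -> L2 I (fun x => gamma%:C * p x - q x).
Proof.
move=> Lp Lq; apply: L2_lin => //.
have -> : (fun x => - q x) = (fun x => -1 * q x) by apply/funext => x; ring.
exact: L2_scale.
Qed.

Lemma Hwide_lin c U W : Hwide U -> Hwide W -> Hwide (c *: U + W).
Proof.
case: U W => [[[[[V f] p] P] g] q] [[[[[V' f'] p'] P'] g'] q'].
move=> [[h1 h2 h3] [h4 h5 h6]] [[h1' h2' h3'] [h4' h5' h6']].
have mT : measurable (setT : set R) by [].
rewrite state_linE; split; split; [exact: (H1_lin c h1 h1')|exact: (L2_lin c mI h2 h2')|
  exact: (L2_lin c mT h3 h3')|exact: (H1_lin c h4 h4')|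
  exact: (L2_lin c mI h5 h5')|exact: (L2_lin c mT h6 h6')].
Qed.

Lemma Hsp_Hwide : Hsp L `<=` Hwide.
Proof.
move=> [[[[[V f] p] P] g] q] [[[h1 _] h2 h3] [[h4 _] h5 h6]].
by do 2 split.
Qed.

(** The norm of H computed with any choice of weak derivatives. *)
Lemma normH_sqr V f phi1 P g phi2 p q : Hwide (V, f, phi1, P, g, phi2) ->
  L2 I p -> L2 I q -> is_wderiv L V p -> is_wderiv L P q ->
  nrm (V, f, phi1, P, g, phi2) =
  Num.sqrt (energy f g p (fun x => gamma%:C * p x - q x) phi1 phi2).
Proof.
move=> [[hV Lf L1] [hP Lg L2']] Lp Lq dV dP.
have mT : measurable (setT : set R) by [].
have [LVx dVx] := wderivP hV; have [LPx dPx] := wderivP hP.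
have aV : ae_eq lambda I (wderiv L V) p by exact: is_wderiv_unique dVx dV.
have aP : ae_eq lambda I (wderiv L P) q by exact: is_wderiv_unique dPx dP.
rewrite /normH; congr Num.sqrt.
rewrite (_ : energy _ _ _ _ _ _ = energy f g (wderiv L V)
  (fun x => gamma%:C * wderiv L V x - wderiv L P x) phi1 phi2); last first.
  apply: energy_ae; split=> //; try exact: L2_comb; try exact: ae_eq_refl.
    exact: ae_eq_sym.
  by apply: filterS2 aV aP => x e1 e2 Dx; rewrite e1// e2.
rewrite /inner; cbv beta iota zeta; set Vx := wderiv L V; set Px := wderiv L P.
have ReM (k : R) (z : R[i]) : Re (k%:C * z) = k * Re z.
  by case: z => x y /=; rewrite mul0r subr0.
have Re_D (z t : R[i]) : Re (z + t) = Re z + Re t by case: z t => [? ?] [].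
have sqcJ (k : R) (z : R[i]) : Re (k%:C * z * conjc z) = k * sqc z.
  by case: z => x y; rewrite /sqc /=; ring.
rewrite Re_D ReM /energy /sqnorm /cint /=; congr (_ + _ * _).
  have i1 := integrableZr rho mI (L2_sqc_integrable Lf).
  have i2 := integrableZr mu mI (L2_sqc_integrable Lg).
  have i3 := integrableZr alpha1 mI (L2_sqc_integrable LVx).
  have i4 := integrableZr beta mI (L2_sqc_integrable (L2_comb LVx LPx)).
  rewrite -!RintegralZl; try by []; try exact: L2_sqc_integrable; last first.
    by apply: L2_sqc_integrable; exact: L2_comb.
  have i12 := integrableDr mI i1 i2; have i123 := integrableDr mI i12 i3.
  rewrite -!RintegralD//.
  by apply: eq_Rintegral => x _; rewrite !Re_D !sqcJ.
rewrite -!RintegralZl//; do ?exact: L2_sqc_integrable.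
rewrite -RintegralD//.
- by apply: eq_Rintegral => x _; rewrite !Re_D !sqcJ.
- by apply: integrableZr => //; exact: L2_sqc_integrable.
- by apply: integrableZr => //; exact: L2_sqc_integrable.
Qed.

Lemma sqrt_triangle (x y z : R) : 0 <= x -> 0 <= y ->
  (forall e, 0 < e -> z <= (1 + e) * x + (1 + e^-1) * y) ->
  Num.sqrt z <= Num.sqrt x + Num.sqrt y.
Proof.
move=> x0 y0 h.
have s0 : 0 <= Num.sqrt x + Num.sqrt y by rewrite addr_ge0 ?sqrtr_ge0.
suff H (d : R) : 0 < d -> Num.sqrt z <= Num.sqrt x + Num.sqrt y + d.
  apply/ler_addgt0Pr => d d0; exact: H.
move=> d0; set u := Num.sqrt x; set v := Num.sqrt y.
have u0 : 0 <= u by exact: sqrtr_ge0.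
have v0 : 0 <= v by exact: sqrtr_ge0.
pose u' := u + d / 2; pose v' := v + d / 2.
have u'0 : 0 < u' by rewrite ltr_wpDl// divr_gt0.
have v'0 : 0 < v' by rewrite ltr_wpDl// divr_gt0.
have -> : u + v + d = Num.sqrt ((u' + v') ^+ 2).
  by rewrite sqrtr_sqr gtr0_norm ?(addr_gt0 u'0 v'0)// /u' /v'; lra.
apply: ler_wsqrtr; apply: (le_trans (h (v' / u') _)); first exact: divr_gt0.
have xu : x <= u' ^+ 2 by rewrite -(sqr_sqrtr x0) ler_pXn2r// ?nnegrE ?ltW// /u' -/u; lra.
have yv : y <= v' ^+ 2 by rewrite -(sqr_sqrtr y0) ler_pXn2r// ?nnegrE ?ltW// /v' -/v; lra.
have -> : (u' + v') ^+ 2 = (1 + v' / u') * u' ^+ 2 + (1 + (v' / u')^-1) * v' ^+ 2.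
  by rewrite invf_div; field; rewrite !gt_eqF.
by rewrite lerD// ler_wpM2l// addr_ge0// ?invr_ge0 ltW// divr_gt0.
Qed.

Lemma normH_ge0 U : 0 <= nrm U.
Proof. by rewrite /normH; exact: sqrtr_ge0. Qed.

Lemma normHZ c U : Hwide U -> nrm (c *: U) = normc c * nrm U.
Proof.
case: U => [[[[[V f] p1] P] g] p2] hU.
have := hU => -[[hV Lf L1] [hP Lg L2']].
have mT : measurable (setT : set R) by [].
have [LVx dVx] := wderivP hV; have [LPx dPx] := wderivP hP.
have hcU : Hwide (c *: ((V, f, p1, P, g, p2) : state R)).
  have -> : c *: ((V, f, p1, P, g, p2) : state R) =
    (c - 1) *: (V, f, p1, P, g, p2) + (V, f, p1, P, g, p2).
    by rewrite scalerBl scale1r subrK.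
  exact: Hwide_lin.
have wd (h w : R -> R[i]) : H1 L h -> L2 I w -> is_wderiv L h w ->
    is_wderiv L (fun x => c * h x) (fun x => c * w x).
  move=> [Lh _] Lw dh.
  have := is_wderiv_lin (c - 1) Lh Lw Lh Lw dh dh.
  by congr is_wderiv; apply/funext => x; ring.
rewrite (normH_sqr hU LVx LPx dVx dPx).
rewrite (normH_sqr hcU (L2_scale c mI LVx) (L2_scale c mI LPx) (wd _ _ hV LVx dVx)
   (wd _ _ hP LPx dPx)).
rewrite -[normc c]ger0_norm ?sqrtr_ge0//; last by case: (c) => ? ?; exact: sqrtr_ge0.
rewrite -sqrtr_sqr -sqrtrM ?sqr_ge0// -sqcE -energyZ; last 2 first.
- by split.
- by split=> //; exact: L2_comb.
congr (Num.sqrt (energy _ _ _ _ _ _)).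
by apply/funext => x; ring.
Qed.

Lemma normHD U W : Hwide U -> Hwide W -> nrm (U + W) <= nrm U + nrm W.
Proof.
case: U W => [[[[[V f] p1] P] g] p2] [[[[[V' f'] p1'] P'] g'] p2'] hU hW.
have := hU => -[[hV Lf Lp1] [hP Lg Lp2]]; have := hW => -[[hV' Lf' Lp1'] [hP' Lg' Lp2']].
have mT : measurable (setT : set R) by [].
have [LVx dVx] := wderivP hV; have [LPx dPx] := wderivP hP.
have [LVx' dVx'] := wderivP hV'; have [LPx' dPx'] := wderivP hP'.
have hUW : Hwide ((V, f, p1, P, g, p2) + (V', f', p1', P', g', p2') : state R).
  rewrite -[X in X + _]scale1r; exact: Hwide_lin.
have LD E (h h' : R -> R[i]) : measurable E -> L2 E h -> L2 E h' ->
    L2 E (fun x => h x + h' x).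
  move=> mE Lh Lh'; have := L2_lin 1 mE Lh Lh'.
  by congr L2; apply/funext => x; rewrite mul1r.
have wd (h w h' w' : R -> R[i]) : H1 L h -> L2 I w -> is_wderiv L h w ->
    H1 L h' -> L2 I w' -> is_wderiv L h' w' ->
    is_wderiv L (fun x => h x + h' x) (fun x => w x + w' x).
  move=> [Lh _] Lw dh [Lh' _] Lw' dh'.
  have := is_wderiv_lin 1 Lh Lw Lh' Lw' dh dh'.
  by congr is_wderiv; apply/funext => x; rewrite mul1r.
rewrite (normH_sqr hU LVx LPx dVx dPx) (normH_sqr hW LVx' LPx' dVx' dPx').
rewrite (normH_sqr hUW (LD I _ _ mI LVx LVx') (LD I _ _ mI LPx LPx')
  (wd _ _ _ _ hV LVx dVx hV' LVx' dVx') (wd _ _ _ _ hP LPx dPx hP' LPx' dPx')).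
apply: sqrt_triangle; [exact: energy_ge0..|] => e e0.
have LC := L2_comb LVx LPx; have LC' := L2_comb LVx' LPx'.
have := @energyD e f g (wderiv L V) _ p1 p2 f' g' (wderiv L V') _ p1' p2' e0
  (And3 Lf Lg LVx) (And3 LC Lp1 Lp2) (And3 Lf' Lg' LVx') (And3 LC' Lp1' Lp2').
rewrite (_ : (fun x => gamma%:C * wderiv L V x - wderiv L P x +
  (gamma%:C * wderiv L V' x - wderiv L P' x)) = (fun x =>
   gamma%:C * (wderiv L V x + wderiv L V' x) - (wderiv L P x + wderiv L P' x))) //.
by apply/funext => x; ring.
Qed.

Lemma normH_eq U W : Hwide U -> Hwide W -> eqHsp L U W -> nrm U = nrm W.
Proof.
case: U W => [[[[[V f] p1] P] g] p2] [[[[[V' f'] p1'] P'] g'] p2'] hU hW.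
have := hU => -[[hV Lf Lp1] [hP Lg Lp2]]; have := hW => -[[hV' Lf' Lp1'] [hP' Lg' Lp2']].
move=> [[eV ef e1] [eP eg e2]].
have [LVx dVx] := wderivP hV; have [LPx dPx] := wderivP hP.
have [LVx' dVx'] := wderivP hV'; have [LPx' dPx'] := wderivP hP'.
rewrite (normH_sqr hU LVx LPx dVx dPx) (normH_sqr hW LVx' LPx' dVx' dPx').
congr Num.sqrt.
have aV := wderiv_ae hV hV' eV; have aP := wderiv_ae hP hP' eP.
apply: energy_ae; split=> //; try exact: L2_comb.
by apply: filterS2 aV aP => x h1 h2 Dx; rewrite h1// h2.
Qed.

Lemma Hsp_0 : Hsp L (0 : state R).
Proof.
have h1 := H1s_0 L_gt0.
have mT : measurable (setT : set R) by [].
by split; split; [exact: h1|exact: (L2_0 mI)|exact: (L2_0 mT)|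
  exact: h1|exact: (L2_0 mI)|exact: (L2_0 mT)].
Qed.

Lemma Hsp_scale c U : Hsp L U -> Hsp L (c *: U).
Proof.
case: U => [[[[[V f] p1] P] g] p2] [[hV Lf L1] [hP Lg L2']].
have mT : measurable (setT : set R) by [].
by rewrite state_scaleE; split; split;
  [exact: H1s_scale|exact: L2_scale|exact: L2_scale|
   exact: H1s_scale|exact: L2_scale|exact: L2_scale].
Qed.

End EnergyNorm.

(** * Integrability of powers on the line *)

Section PowerIntegrals.
Variable R : realType.
Local Notation mu := (@lebesgue_measure R).
Implicit Types (c d s x : R).

Let p s x : R := `|x| `^ (s - 1).

Let p_ge0 s x : 0 <= p s x. Proof. exact: powR_ge0. Qed.

Lemma measurable_norm_powR D s : measurable_fun D (p s).
Proof.
apply: measurable_funTS.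
by apply: (@measurableT_comp _ _ _ _ _ _ (fun x => x `^ (s - 1))).
Qed.

Lemma continuous_powR s x : 0 < x -> {for x, continuous (fun x => x `^ s)}.
Proof.
move=> x0; apply: differentiable_continuous; apply/derivable1_diffP.
by apply: derivable_powR; rewrite in_itv/= andbT.
Qed.

Lemma integral_powR c d s : s != 0 -> 0 < c -> c < d ->
  (\int[mu]_(x in `[c, d]) (x `^ (s - 1))%:E = ((d `^ s - c `^ s) / s)%:E)%E.
Proof.
move=> s0 c0 cd.
have dF x : 0 < x -> is_derive x 1 (fun x => x `^ s / s) (x `^ (s - 1)).
  move=> x0.
  have x0' : x \in `]0, +oo[ by rewrite in_itv/= andbT.
  have D : is_derive x 1 (fun x => x `^ s) (s * x `^ (s - 1)).
    split; first exact: derivable_powR.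
    by rewrite -derive1E powR_derive1.
  have -> : (fun x => x `^ s / s) = (fun x => s^-1 * x `^ s).
    by apply/funext => y; rewrite mulrC.
  by apply: is_derive_eq; rewrite /GRing.scale/= mulrA mulVf ?mul1r.
have cF x : 0 < x -> {for x, continuous (fun x => x `^ s / s)}.
  move=> x0; apply: differentiable_continuous; apply/derivable1_diffP.
  by have [] := dF _ x0.
have d0 := lt_trans c0 cd.
rewrite (@continuous_FTC2 _ _ (fun x => x `^ s / s) c d)//.
- by rewrite -EFinB -mulrBl.
- apply: continuous_in_subspaceT => x; rewrite inE/= in_itv/= => /andP[cx _].
  by apply: continuous_powR; exact: lt_le_trans cx.
- split.
  + move=> x; rewrite in_itv/= => /andP[cx _].
    by have [] := dF x (lt_trans c0 cx).
  + by apply: cvg_at_right_filter; exact: cF.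
  + by apply: cvg_at_left_filter; exact: cF.
- move=> x; rewrite in_itv/= => /andP[cx _].
  by rewrite derive1E; have [_ ->] := dF x (lt_trans c0 cx).
Qed.

Lemma integral_norm_powR c d s : s != 0 -> 0 < c -> c < d ->
  (\int[mu]_(x in `[c, d]) (p s x)%:E = ((d `^ s - c `^ s) / s)%:E)%E /\
  (\int[mu]_(x in `[(- d)%R, (- c)%R]) (p s x)%:E = ((d `^ s - c `^ s) / s)%:E)%E.
Proof.
move=> s0 c0 cd.
have E : (\int[mu]_(x in `[c, d]) (p s x)%:E = ((d `^ s - c `^ s) / s)%:E)%E.
  rewrite -(integral_powR s0 c0 cd); apply: eq_integral => x.
  rewrite inE/= in_itv/= => /andP[cx _].
  by rewrite /p ger0_norm// ltW// (lt_le_trans c0).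
split=> //; rewrite -E integration_by_substitution_oppr.
- by apply: eq_integral => x _; rewrite /= /p normrN.
- exact: ltW.
- apply: continuous_in_subspaceT => x; rewrite inE/= in_itv/= => /andP[_ xc].
  have x0 : x < 0 by rewrite (le_lt_trans xc)// oppr_lt0.
  apply: (@continuous_comp _ _ _ (@Num.norm _ R) (fun x => x `^ (s - 1))).
    exact: norm_continuous.
  by apply: continuous_powR; rewrite normr_gt0 lt_eqF.
Qed.

(** A nonnegative function is integrable on the union of an increasing sequence
    of sets on which its integrals are bounded. *)
Lemma integrable_exhaust (f : R -> R) (E : nat -> set R) (C : R) :
  measurable_fun setT f -> (forall x, 0 <= f x) ->
  (forall n, measurable (E n)) -> nondecreasing_seq E ->
  (forall n, \int[mu]_(x in E n) (f x)%:E <= C%:E)%E ->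
  mu.-integrable (\bigcup_n E n) (EFin \o f).
Proof.
move=> mf f0 mE ndE EC.
have mU : measurable (\bigcup_n E n) by exact: bigcupT_measurable.
apply/integrableP; split.
  by apply/measurable_EFinP; exact: measurable_funTS.
have cv : (\int[mu]_(x in E n) (f x)%:E)%E @[n --> \oo] -->
    (\int[mu]_(x in \bigcup_n E n) (f x)%:E)%E.
  apply: ge0_nondecreasing_set_cvg_integral => //.
  - by move=> i; apply/measurable_EFinP; exact: measurable_funTS.
  - by move=> i x _; rewrite lee_fin.
apply: (@le_lt_trans _ _ C%:E); last exact: ltry.
rewrite (_ : (\int[_]_(x in _) _)%E = (\int[mu]_(x in \bigcup_n E n) (f x)%:E)%E).
  by apply: cvge_to_le cv _; exact: nearW.
by apply: eq_integral => x _ /=; rewrite ger0_norm.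
Qed.

Let harm n : 0 < (n.+2%:R^-1 : R) < 1.
Proof. by rewrite invr_gt0 ltr0n/= invf_lt1 ?ltr1n. Qed.

Lemma integrable_powR_near0 s : 0 < s ->
  mu.-integrable `]0, 1] (EFin \o p s) /\
  mu.-integrable `[-1, 0[ (EFin \o p s).
Proof.
move=> s0; pose E n : set R := `[n.+2%:R^-1, 1]%classic.
pose E' n : set R := `[-1, - n.+2%:R^-1]%classic.
have bd n : (1 `^ s - n.+2%:R^-1 `^ s) / s <= s^-1.
  by rewrite powR1 ler_pdivrMr// mulVf ?gt_eqF// gerBl powR_ge0.
have nd (n m : nat) : (n <= m)%N -> m.+2%:R^-1 <= n.+2%:R^-1 :> R.
  by move=> nm; rewrite lef_pV2 ?posrE ?ltr0n// ler_nat.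
have ex x : 0 < x -> exists n : nat, n.+2%:R^-1 <= x.
  move=> x0; exists (Num.truncn x^-1); rewrite invf_ple ?posrE//.
  by rewrite ltW// (lt_trans (truncnS_gt _))// ltr_nat.
have s0' : s != 0 by rewrite gt_eqF.
split.
  rewrite (_ : `]0, 1]%classic = \bigcup_n E n); last first.
    apply/seteqP; split=> x /=.
      rewrite in_itv/= => /andP[/ex[n nx] x1].
      by exists n => //; rewrite /E /= in_itv/= nx.
    move=> [n _]; rewrite /E /= !in_itv/= => /andP[nx ->]; rewrite andbT.
    by apply: lt_le_trans nx; have /andP[] := harm n.
  apply: (integrable_exhaust (C := s^-1)) => //.
  - exact: measurable_norm_powR.
  - by move=> n; exact: measurable_itv.
  - move=> n m nm; apply/subsetPset => x; rewrite /E /= !in_itv/= => /andP[nx ->].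
    by rewrite (le_trans (nd _ _ nm)).
  - move=> n; have /andP[h0 h1] := harm n.
    by have [-> _] := integral_norm_powR s0' h0 h1; rewrite lee_fin.
rewrite (_ : `[-1, 0[%classic = \bigcup_n E' n); last first.
  apply/seteqP; split=> x /=.
    rewrite in_itv/= -oppr_gt0 => /andP[x1 /ex[n nx]].
    by exists n => //; rewrite /E' /= in_itv/= x1 lerNr.
  move=> [n _]; rewrite /E' /= !in_itv/= => /andP[-> nx] /=.
  by apply: (le_lt_trans nx); rewrite oppr_lt0; have /andP[] := harm n.
apply: (integrable_exhaust (C := s^-1)) => //.
- exact: measurable_norm_powR.
- by move=> n; exact: measurable_itv.
- move=> n m nm; apply/subsetPset => x; rewrite /E' /= !in_itv/= => /andP[-> nx] /=.
  by rewrite (le_trans nx)// lerN2 nd.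
- move=> n; have /andP[h0 h1] := harm n.
  by have [_ ->] := integral_norm_powR s0' h0 h1; rewrite lee_fin.
Qed.

Lemma integrable_powR_infty s : s < 0 ->
  mu.-integrable `[1, +oo[ (EFin \o p s) /\
  mu.-integrable `]-oo, -1] (EFin \o p s).
Proof.
move=> s0; pose E n : set R := `[1, n.+2%:R]%classic.
pose E' n : set R := `[- n.+2%:R, -1]%classic.
have bd n : (n.+2%:R `^ s - 1 `^ s) / s <= - s^-1.
  by rewrite powR1 mulrBl mul1r gerDr mulr_ge0_le0 ?powR_ge0// invr_le0 ltW.
have nd (n m : nat) : (n <= m)%N -> n.+2%:R <= m.+2%:R :> R.
  by move=> nm; rewrite ler_nat.
have ex x : exists n : nat, x <= n.+2%:R.
  exists (Num.truncn x).
  by rewrite ltW// (lt_trans (truncnS_gt _))// ltr_nat.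
have s0' : s != 0 by rewrite lt_eqF.
have lt1n n : 1 < n.+2%:R :> R by rewrite ltr1n.
split.
  rewrite (_ : `[1, +oo[%classic = \bigcup_n E n); last first.
    apply/seteqP; split=> x /=.
      rewrite in_itv/= andbT => x1; have [n nx] := ex x.
      by exists n => //; rewrite /E /= in_itv/= x1.
    by move=> [n _]; rewrite /E /= !in_itv/= => /andP[-> _].
  apply: (integrable_exhaust (C := - s^-1)) => //.
  - exact: measurable_norm_powR.
  - by move=> n; exact: measurable_itv.
  - move=> n m nm; apply/subsetPset => x; rewrite /E /= !in_itv/= => /andP[-> nx] /=.
    by rewrite (le_trans nx)// nd.
  - move=> n.
    by have [-> _] := integral_norm_powR s0' ltr01 (lt1n n); rewrite lee_fin.
rewrite (_ : `]-oo, -1]%classic = \bigcup_n E' n); last first.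
  apply/seteqP; split=> x /=.
    rewrite in_itv/= => x1; have [n nx] := ex (- x).
    by exists n => //; rewrite /E' /= in_itv/= x1 lerNl nx.
  by move=> [n _]; rewrite /E' /= !in_itv/= => /andP[_ ->].
apply: (integrable_exhaust (C := - s^-1)) => //.
- exact: measurable_norm_powR.
- by move=> n; exact: measurable_itv.
- move=> n m nm; apply/subsetPset => x; rewrite /E' /= !in_itv/= => /andP[nx ->].
  by rewrite andbT (le_trans _ nx)// lerN2 nd.
- move=> n.
  by have [_ ->] := integral_norm_powR s0' ltr01 (lt1n n); rewrite lee_fin.
Qed.

End PowerIntegrals.

(** * The diffusive kernels *)

Section DiffusiveKernel.
Variables (R : realType) (eta a : R).
Hypotheses (eta_gt0 : 0 < eta) (a_gt0 : 0 < a) (a_lt1 : a < 1).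
Local Notation mu := (@lebesgue_measure R).
Local Notation varpi := (varpi a).
Implicit Types (x xi lam : R).

Let mT : measurable (setT : set R). Proof. by []. Qed.

Local Notation s xi := (xi ^+ 2 + eta).

Let s_gt0 xi : 0 < s xi.
Proof. by rewrite ltr_wpDl// sqr_ge0. Qed.

Lemma measurable_varpi : measurable_fun setT varpi.
Proof.
have : measurable_fun setT (fun x : R => `|x| `^ ((2 * a - 1) / 2)).
  by apply: (@measurableT_comp _ _ _ _ _ _ (fun x : R => x `^ ((2 * a - 1) / 2))).
exact.
Qed.

Lemma varpi_sqr xi : xi != 0 -> varpi xi ^+ 2 = `|xi| `^ (2 * a - 1).
Proof.
move=> xi0; rewrite /Defs.varpi expr2 -powRD; last by rewrite normr_eq0 xi0 implybT.
by congr (_ `^ _); field.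
Qed.

Lemma varpi_ge0 xi : 0 <= varpi xi. Proof. exact: powR_ge0. Qed.

Lemma varpi0_le1 : varpi 0 ^+ 2 <= 1.
Proof.
rewrite /Defs.varpi normr0.
have [->|h] := eqVneq ((2 * a - 1) / 2) 0; first by rewrite powRr0 expr1n.
by rewrite powR0// expr0n.
Qed.

Let restr_integrable (D : set R) (u : R -> R) : measurable D ->
  mu.-integrable D (EFin \o u) -> mu.-integrable setT (EFin \o (u \_ D)).
Proof. by move=> mD iu; rewrite -restrict_EFin; exact/(integrable_mkcond _ _).1. Qed.

(** The exponent 2a - 1 exceeds -1, which gives integrability at 0, and 2a - 3
    is below -1, which gives integrability at infinity. *)
Lemma varpi_sqr_integrable :
  mu.-integrable setT (EFin \o (fun xi => varpi xi ^+ 2 / (xi ^+ 2 + eta))).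
Proof.
have [i1 i2] : mu.-integrable `]0, 1] (EFin \o (fun x => `|x| `^ (2 * a - 1))) /\
    mu.-integrable `[-1, 0[ (EFin \o (fun x => `|x| `^ (2 * a - 1))).
  by apply: integrable_powR_near0; rewrite mulr_gt0.
have [i3 i4] : mu.-integrable `[1, +oo[ (EFin \o (fun x => `|x| `^ (2 * a - 2 - 1))) /\
    mu.-integrable `]-oo, -1] (EFin \o (fun x => `|x| `^ (2 * a - 2 - 1))).
  by apply: integrable_powR_infty; rewrite subr_lt0 gtr_pMr.
have i0 : mu.-integrable `[-1, 1] (EFin \o cst (eta^-1)).
  apply: continuous_compact_integrable; first exact: segment_compact.
  by move=> x; exact: cvg_cst.
have j0 := restr_integrable (measurable_itv _) i0.
have j1 := restr_integrable (measurable_itv _) (integrableZr eta^-1 (measurable_itv _) i1).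
have j2 := restr_integrable (measurable_itv _) (integrableZr eta^-1 (measurable_itv _) i2).
have j3 := restr_integrable (measurable_itv _) i3.
have j4 := restr_integrable (measurable_itv _) i4.
have J := integrableDr mT (integrableDr mT (integrableDr mT
  (integrableDr mT j0 j1) j2) j3) j4.
apply: integrable_dominated J => //.
  apply: measurable_funM.
    by apply: measurable_funX; exact: measurable_varpi.
  apply: continuous_measurable_fun => x; apply: cvgV; first by rewrite gt_eqF ?s_gt0.
  by apply: cvgD; [apply: cvgM|]; (exact: cvg_id || exact: cvg_cst).
move=> x _; rewrite ger0_norm; last by rewrite divr_ge0 ?sqr_ge0// ltW ?s_gt0.
have ge0 (D : set R) (u : R -> R) : (forall x, 0 <= u x) -> 0 <= (u \_ D) x.
  by move=> u0; rewrite patchE; case: ifP.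
have eV : 0 <= eta^-1 by rewrite invr_ge0 ltW.
have g0 := ge0 `[-1, 1]%classic (cst eta^-1) (fun=> eV).
have g1 := ge0 `]0, 1]%classic (fun x => eta^-1 * `|x| `^ (2 * a - 1))
  (fun=> mulr_ge0 eV (powR_ge0 _ _)).
have g2 := ge0 `[-1, 0[%classic (fun x => eta^-1 * `|x| `^ (2 * a - 1))
  (fun=> mulr_ge0 eV (powR_ge0 _ _)).
have g3 := ge0 `[1, +oo[%classic (fun x => `|x| `^ (2 * a - 2 - 1))
  (fun=> powR_ge0 _ _).
have g4 := ge0 `]-oo, -1]%classic (fun x => `|x| `^ (2 * a - 2 - 1))
  (fun=> powR_ge0 _ _).
have sV : (x ^+ 2 + eta)^-1 <= eta^-1.
  by rewrite lef_pV2 ?posrE ?s_gt0// lerDr sqr_ge0.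
have bnd_near : x != 0 -> varpi x ^+ 2 / (x ^+ 2 + eta) <= eta^-1 * `|x| `^ (2 * a - 1).
  by move=> x0; rewrite varpi_sqr// mulrC ler_wpM2r// powR_ge0.
have bnd_far : x != 0 -> varpi x ^+ 2 / (x ^+ 2 + eta) <= `|x| `^ (2 * a - 2 - 1).
  move=> x0; rewrite varpi_sqr//.
  rewrite (_ : 2 * a - 2 - 1 = 2 * a - 1 - 2%:R); last by ring.
  rewrite (@powRB _ _ (2 * a - 1) 2%:R) ?normr_eq0 ?x0 ?implybT//.
  rewrite powR_mulrn// real_normK ?num_real//.
  rewrite ler_wpM2l ?powR_ge0// lef_pV2 ?posrE ?s_gt0// ?lerDl ?ltW//.
  by rewrite exprn_even_gt0.
have itvE (D : set R) (u : R -> R) : D x -> (u \_ D) x = u x.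
  by move=> Dx; rewrite patchE mem_set.
have [x0|xn] := eqVneq x 0.
  apply: (@le_trans _ _ eta^-1).
    rewrite x0 expr0n add0r -[leRHS]mul1r ler_wpM2r//; exact: varpi0_le1.
  move: g1 g2 g3 g4.
  rewrite (itvE `[-1, 1]%classic); first by move=> /=; lra.
  by rewrite /= in_itv/= x0 lerN10 ler01.
have [x1|x1] := leP x (-1).
  apply: (le_trans (bnd_far xn)); move: g0 g1 g2 g3.
  rewrite (itvE `]-oo, -1]%classic); first by move=> /=; lra.
  by rewrite /= in_itv/=.
have [x2|x2] := leP 1 x.
  apply: (le_trans (bnd_far xn)); move: g0 g1 g2 g4.
  rewrite (itvE `[1, +oo[%classic); first by move=> /=; lra.
  by rewrite /= in_itv/= x2.
have [x0|x0] := ltP x 0.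
  apply: (le_trans (bnd_near xn)); move: g0 g1 g3 g4.
  rewrite (itvE `[-1, 0[%classic); first by move=> /=; lra.
  by rewrite /= in_itv/= x0 ltW.
apply: (le_trans (bnd_near xn)); move: g0 g2 g3 g4.
rewrite (itvE `]0, 1]%classic); first by move=> /=; lra.
by rewrite /= in_itv/= lt_neqAle eq_sym xn x0 ltW.
Qed.

(** The real and imaginary parts of i / (i lam + xi^2 + eta). *)
Definition kerA lam xi : R := lam / (s xi ^+ 2 + lam ^+ 2).
Definition kerB lam xi : R := s xi / (s xi ^+ 2 + lam ^+ 2).

Let den_gt0 lam xi : 0 < s xi ^+ 2 + lam ^+ 2.
Proof. by rewrite ltr_pwDl ?sqr_ge0// exprn_gt0. Qed.

Lemma ker_bounds lam xi : 0 < lam ->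
  [/\ 0 <= kerA lam xi, kerA lam xi <= (s xi)^-1 & kerA lam xi <= lam^-1] /\
  [/\ 0 <= kerB lam xi, kerB lam xi <= (s xi)^-1 & kerB lam xi <= lam^-1].
Proof.
move=> lam0; have := s_gt0 xi; have := den_gt0 lam xi.
rewrite /kerA /kerB; move: (s xi) => t d0 s0.
have lam0' := ltW lam0; have s0' := ltW s0; have d0' := ltW d0.
by split; split; rewrite ?divr_ge0// ler_pdivrMr// mulrC
  ler_pdivlMr//; nra.
Qed.

Lemma ker_resolvent lam xi :
  s xi * kerA lam xi - lam * kerB lam xi = 0 /\
  s xi * kerB lam xi + lam * kerA lam xi = 1.
Proof.
have d0 := den_gt0 lam xi; rewrite /kerA /kerB; split; field; rewrite gt_eqF//.
Qed.

Let continuous_s : continuous (fun xi => s xi).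
Proof. by move=> x; apply: cvgD; [apply: cvgM|]; (exact: cvg_id || exact: cvg_cst). Qed.

Let continuous_den lam : continuous (fun xi => (s xi ^+ 2 + lam ^+ 2)^-1).
Proof.
move=> x; apply: cvgV; first by rewrite gt_eqF ?den_gt0.
by apply: cvgD; [apply: cvgM; exact: continuous_s|exact: cvg_cst].
Qed.

Lemma measurable_kerA lam : measurable_fun setT (kerA lam).
Proof.
apply: continuous_measurable_fun => x.
by apply: cvgM; [exact: cvg_cst|exact: continuous_den].
Qed.

Lemma measurable_kerB lam : measurable_fun setT (kerB lam).
Proof.
apply: continuous_measurable_fun => x.
by apply: cvgM; [exact: continuous_s|exact: continuous_den].
Qed.

(** kerA and kerB are used only through the following bounds. *)
Section Kernel.
Variable k : R -> R.
Hypotheses (mk : measurable_fun setT k) (k_ge0 : forall xi, 0 <= k xi).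
Hypothesis k_le : forall xi, k xi <= (s xi)^-1.

Lemma varpi_sqr_kernel_integrable :
  mu.-integrable setT (EFin \o (fun xi => varpi xi ^+ 2 * k xi)).
Proof.
apply: integrable_dominated varpi_sqr_integrable => //.
  apply: measurable_funM => //; apply: measurable_funX; exact: measurable_varpi.
move=> x _; rewrite ger0_norm ?mulr_ge0 ?sqr_ge0 ?varpi_ge0//.
by rewrite ler_wpM2l ?sqr_ge0//; exact: k_le.
Qed.

Lemma varpi_kernel_L2r : L2r setT (fun xi => varpi xi * k xi).
Proof.
split; first by apply: measurable_funM => //; exact: measurable_varpi.
have J := integrableZr eta^-1 mT varpi_sqr_integrable.
have mw := measurable_varpi.
apply: integrable_dominated J => //.
  by apply: measurable_funX; apply: measurable_funM.
move=> x _; rewrite ger0_norm ?sqr_ge0// exprMn [leRHS]mulrCA.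
rewrite ler_wpM2l ?sqr_ge0// expr2 ler_pM//.
by rewrite (le_trans (k_le x))// lef_pV2 ?posrE// lerDr sqr_ge0.
Qed.

Lemma norm_varpi_kernel_L2r : L2r setT (fun xi => `|xi| * (varpi xi * k xi)).
Proof.
have mw := measurable_varpi.
have mf : measurable_fun setT (fun xi => `|xi| * (varpi xi * k xi)).
  apply: measurable_funM; first exact: normr_measurable.
  exact: measurable_funM.
split => //; apply: integrable_dominated varpi_sqr_integrable => //.
  exact: measurable_funX.
move=> x _; rewrite ger0_norm ?sqr_ge0// !exprMn real_normK ?num_real// [leLHS]mulrCA.
rewrite ler_wpM2l ?sqr_ge0//; have s0 := s_gt0 x; have h := k_le x.
have xs : x ^+ 2 <= s x by rewrite lerDl ltW.
apply: (@le_trans _ _ (s x * (s x)^-1 ^+ 2)).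
  by rewrite ler_pM ?sqr_ge0// ler_pXn2r ?nnegrE// invr_ge0 ltW.
by rewrite expr2 mulrA divff ?gt_eqF// mul1r.
Qed.

End Kernel.

(** With k = kerA or kerB: the feedback vanishes in the limit of high
    frequencies lam = u n. *)
Lemma cvg_varpi_kernel (k : R -> R -> R) (u : nat -> R) :
  (forall lam, measurable_fun setT (k lam)) ->
  (forall lam xi, 0 < lam ->
    [/\ 0 <= k lam xi, k lam xi <= (s xi)^-1 & k lam xi <= lam^-1]) ->
  (forall n, 0 < u n) -> (u n)^-1 @[n --> \oo] --> 0 ->
  (\int[mu]_xi (varpi xi ^+ 2 * k (u n) xi)) @[n --> \oo] --> (0 : R).
Proof.
move=> mk kb u0 ul.
have mw := measurable_varpi.
have := @Rintegral_dominated_cvg R setT (fun n xi => varpi xi ^+ 2 * k (u n) xi)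
  (cst 0) (fun xi => varpi xi ^+ 2 / (xi ^+ 2 + eta)) mT.
rewrite Rintegral_cst// mul0r; apply.
- by move=> n; apply: measurable_funM => //; exact: measurable_funX.
- move=> x _; apply: (@squeeze_cvgr _ _ _ _ (cst 0) (fun n => varpi x ^+ 2 * (u n)^-1)).
  + apply: nearW => n; have [k0 _ kl] := kb (u n) x (u0 n).
    by rewrite mulr_ge0 ?sqr_ge0 ?varpi_ge0//= ler_wpM2l ?sqr_ge0.
  + exact: cvg_cst.
  + by rewrite -[X in _ --> X](mulr0 (varpi x ^+ 2)); apply: cvgMr.
- exact: varpi_sqr_integrable.
- move=> n x _; have [k0 kl _] := kb (u n) x (u0 n).
  by rewrite ger0_norm ?mulr_ge0 ?sqr_ge0 ?varpi_ge0// ler_wpM2l ?sqr_ge0.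
Qed.

End DiffusiveKernel.

(** * Quasi-modes built on real profiles *)

Section SmoothCombinations.
Variables (R : realType).
Local Notation Re := complex.Re.
Local Notation Im := complex.Im.
Implicit Types (v w : R -> R[i]) (c : R[i]).

(** The real profile u0 with a real correction u1 of complex amplitude y. *)
Definition pert (y : R[i]) (u0 u1 : R -> R) : R -> R[i] :=
  fun x => (u0 x)%:C + y * (u1 x)%:C.

Lemma smooth_pert y (u0 u0' u1 u1' : R -> R) :
  (forall x : R, is_derive x 1 u0 (u0' x)) -> (forall x : R, is_derive x 1 u1 (u1' x)) ->
  continuous u0' -> continuous u1' -> smooth (pert y u0 u1) (pert y u0' u1').
Proof.
move=> d0 d1 c0 c1.
have ReE (w0 w1 : R -> R) : (fun x => Re (pert y w0 w1 x)) = (fun x => w0 x + Re y * w1 x).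
  by apply/funext => x; rewrite /pert; case: (y) => p q /=; ring.
have ImE (w0 w1 : R -> R) : (fun x => Im (pert y w0 w1 x)) = (fun x => Im y * w1 x).
  by apply/funext => x; rewrite /pert; case: (y) => p q /=; ring.
have rE (w0 w1 : R -> R) x : Re (pert y w0 w1 x) = w0 x + Re y * w1 x.
  by rewrite /pert; case: (y) => p q /=; ring.
have iE (w0 w1 : R -> R) x : Im (pert y w0 w1 x) = Im y * w1 x.
  by rewrite /pert; case: (y) => p q /=; ring.
rewrite /smooth !ReE !ImE; split.
- move=> x; rewrite rE.
  exact: (is_deriveD (d0 x) (is_deriveZ (Re y) (d1 x))).
- by move=> x; rewrite iE; exact: (is_deriveZ (Im y) (d1 x)).
- by move=> x; apply: cvgD; [exact: c0|apply: cvgMr; exact: c1].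
- by move=> x; apply: cvgMr; exact: c1.
Qed.

Lemma smooth_scale c v w : smooth v w ->
  smooth (fun x => c * v x) (fun x => c * w x).
Proof.
move=> [dr di cr ci].
have ReE (f : R -> R[i]) : (fun x => Re (c * f x)) =
    (fun x => Re c * Re (f x) - Im c * Im (f x)).
  by apply/funext => x; case: (c) (f x) => [? ?] [? ?].
have ImE (f : R -> R[i]) : (fun x => Im (c * f x)) =
    (fun x => Re c * Im (f x) + Im c * Re (f x)).
  by apply/funext => x; case: (c) (f x) => [? ?] [? ?].
have rE x : Re (c * w x) = Re c * Re (w x) - Im c * Im (w x).
  by case: (c) (w x) => [? ?] [? ?].
have iE x : Im (c * w x) = Re c * Im (w x) + Im c * Re (w x).
  by case: (c) (w x) => [? ?] [? ?].
rewrite /smooth !ReE !ImE; split.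
- move=> x; rewrite rE.
  exact: (is_deriveB (is_deriveZ (Re c) (dr x)) (is_deriveZ (Im c) (di x))).
- move=> x; rewrite iE.
  exact: (is_deriveD (is_deriveZ (Re c) (di x)) (is_deriveZ (Im c) (dr x))).
- by move=> x; apply: cvgB; apply: cvgMr; [exact: cr|exact: ci].
- by move=> x; apply: cvgD; apply: cvgMr; [exact: ci|exact: cr].
Qed.

End SmoothCombinations.

Section QuasiMode.
Variable R : realType.
Variables rho alpha alpha1 beta gamma mu L l1 l2 eta a lam C m : R.
Hypotheses (rho_gt0 : 0 < rho) (alpha1_gt0 : 0 < alpha1) (beta_gt0 : 0 < beta).
Hypotheses (mu_gt0 : 0 < mu) (L_gt0 : 0 < L) (l1_gt0 : 0 < l1) (l2_gt0 : 0 < l2).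
Hypotheses (a_gt0 : 0 < a) (a_lt1 : a < 1) (eta_gt0 : 0 < eta) (lam_gt0 : 0 < lam).
Local Notation lambda := (@lebesgue_measure R).
Local Notation Re := complex.Re.
Local Notation Im := complex.Im.
Local Notation I := (`]0, L[%classic : set R).
Local Notation nrm := (normH rho alpha1 beta gamma mu L l1 l2 a).
Local Notation kappa := (sin (a * pi) / pi).

(** (V0, P0) is an undamped standing wave of frequency lam, with zero flux at L;
    (V1, P1) carries the flux that balances the feedback of lam V0 and lam P0.
    The suffixes x and xx denote derivatives. *)
Variables V0 V0x V0xx V1 V1x V1xx P0 P0x P0xx P1 P1x P1xx : R -> R.
Hypotheses (dV0 : forall x : R, is_derive x 1 V0 (V0x x))
  (dV0x : forall x : R, is_derive x 1 V0x (V0xx x)) (cV0 : continuous V0xx)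
  (dV1 : forall x : R, is_derive x 1 V1 (V1x x))
  (dV1x : forall x : R, is_derive x 1 V1x (V1xx x)) (cV1 : continuous V1xx)
  (dP0 : forall x : R, is_derive x 1 P0 (P0x x))
  (dP0x : forall x : R, is_derive x 1 P0x (P0xx x)) (cP0 : continuous P0xx)
  (dP1 : forall x : R, is_derive x 1 P1 (P1x x))
  (dP1x : forall x : R, is_derive x 1 P1x (P1xx x)) (cP1 : continuous P1xx).
Hypotheses (V00 : V0 0 = 0) (V10 : V1 0 = 0) (P00 : P0 0 = 0) (P10 : P1 0 = 0)
  (V1L : V1 L = 0) (P1L : P1 L = 0).
Hypotheses
  (bV0 : alpha * V0x L - gamma * beta * P0x L = 0)
  (bP0 : beta * P0x L - gamma * beta * V0x L = 0)
  (bV1 : alpha * V1x L - gamma * beta * P1x L = l1 * kappa * (lam * V0 L))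
  (bP1 : beta * P1x L - gamma * beta * V1x L = l2 * kappa * (lam * P0 L)).
Hypotheses
  (eV0 : forall x, alpha / rho * V0xx x - gamma * beta / rho * P0xx x
                   + lam ^+ 2 * V0 x = 0)
  (eP0 : forall x, - (gamma * beta / mu) * V0xx x + beta / mu * P0xx x
                   + lam ^+ 2 * P0 x = 0).
Let rV1 x := alpha / rho * V1xx x - gamma * beta / rho * P1xx x + lam ^+ 2 * V1 x.
Let rP1 x := - (gamma * beta / mu) * V1xx x + beta / mu * P1xx x + lam ^+ 2 * P1 x.
Hypotheses (rV1_le : forall x, I x -> `|rV1 x| <= C)
  (rP1_le : forall x, I x -> `|rP1 x| <= C)
  (V1_le : forall x, I x -> `|lam * V1 x| <= C)
  (V0_ge : m <= \int[lambda]_(x in I) (lam * V0 x) ^+ 2).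

Let mI : measurable I. Proof. by []. Qed.
Let mT : measurable (setT : set R). Proof. by []. Qed.

Let IA : R := \int[lambda]_xi (varpi a xi ^+ 2 * kerA eta lam xi).
Let IB : R := \int[lambda]_xi (varpi a xi ^+ 2 * kerB eta lam xi).
Let y : R[i] := (- IA) +i* (- IB).
Let V := pert y V0 V1.
Let P := pert y P0 P1.
Let Vx := pert y V0x V1x.
Let Px := pert y P0x P1x.
Let Vxx := pert y V0xx V1xx.
Let Pxx := pert y P0xx P1xx.
Let il : R[i] := 0 +i* lam.
Let f := fun x => il * V x.
Let g := fun x => il * P x.
Let phi (c : R) : R -> R[i] := fun xi =>
  (c * (varpi a xi * kerA eta lam xi)) +i* (c * (varpi a xi * kerB eta lam xi)).
Let U : state R := (V, f, phi (lam * V0 L), P, g, phi (lam * P0 L)).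
Let A := opA rho alpha beta gamma mu L eta a.

Let cont (u r : R -> R) : (forall x : R, is_derive x 1 u (r x)) -> continuous u.
Proof. exact: is_derive_continuous. Qed.

Let sV : smooth V Vx.
Proof. by apply: smooth_pert => //; [exact: cont dV0x|exact: cont dV1x]. Qed.
Let sVx : smooth Vx Vxx. Proof. exact: smooth_pert. Qed.
Let sP : smooth P Px.
Proof. by apply: smooth_pert => //; [exact: cont dP0x|exact: cont dP1x]. Qed.
Let sPx : smooth Px Pxx. Proof. exact: smooth_pert. Qed.
Let sf : smooth f (fun x => il * Vx x). Proof. exact: smooth_scale. Qed.
Let sg : smooth g (fun x => il * Px x). Proof. exact: smooth_scale. Qed.

Let hA xi : 0 <= kerA eta lam xi.
Proof. by have [[]] := ker_bounds eta_gt0 xi lam_gt0. Qed.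
Let hB xi : 0 <= kerB eta lam xi.
Proof. by have [_ []] := ker_bounds eta_gt0 xi lam_gt0. Qed.
Let hA' xi : kerA eta lam xi <= (xi ^+ 2 + eta)^-1.
Proof. by have [[]] := ker_bounds eta_gt0 xi lam_gt0. Qed.
Let hB' xi : kerB eta lam xi <= (xi ^+ 2 + eta)^-1.
Proof. by have [_ []] := ker_bounds eta_gt0 xi lam_gt0. Qed.

Let L2rZ D (u : R -> R) (k : R) : measurable D -> L2r D u -> L2r D (fun x => k * u x).
Proof.
move=> mD Lu; have := L2r_lin (k - 1) mD Lu Lu.
by congr L2r; apply/funext => x; ring.
Qed.

Let L2phi c : L2 setT (phi c).
Proof.
apply/(L2P _ mT); split; apply: L2rZ => //.
  exact: (varpi_kernel_L2r eta_gt0 a_gt0 a_lt1 (measurable_kerA eta_gt0 lam) hA hA').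
exact: (varpi_kernel_L2r eta_gt0 a_gt0 a_lt1 (measurable_kerB eta_gt0 lam) hB hB').
Qed.

Let L2nphi c : L2 setT (fun xi => `|xi|%:C * phi c xi).
Proof.
have E (k : R -> R) : (fun xi => `|xi| * (c * (varpi a xi * k xi))) =
    (fun xi => c * (`|xi| * (varpi a xi * k xi))).
  by apply/funext => x; ring.
apply/(L2P _ mT); split.
  rewrite (_ : (fun x => _) = fun xi => `|xi| * (c * (varpi a xi * kerA eta lam xi))).
    rewrite E; apply: L2rZ => //.
    exact: (norm_varpi_kernel_L2r eta_gt0 a_gt0 a_lt1 (measurable_kerA eta_gt0 lam) hA hA').
  by apply/funext => x /=; rewrite mul0r subr0.
rewrite (_ : (fun x => _) = fun xi => `|xi| * (c * (varpi a xi * kerB eta lam xi))).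
  rewrite E; apply: L2rZ => //.
  exact: (norm_varpi_kernel_L2r eta_gt0 a_gt0 a_lt1 (measurable_kerB eta_gt0 lam) hB hB').
by apply/funext => x /=; rewrite mul0r addr0.
Qed.

(* phi c solves the diffusive equation driven by the boundary velocity i c *)
Let diffusive_phi (c : R) : diffusive eta a (phi c) (0 +i* c) = (fun xi => il * phi c xi).
Proof.
apply/funext => xi; have [e1 e2] := ker_resolvent eta_gt0 lam xi.
move: e1 e2; rewrite /diffusive /phi /il.
move: (kerA _ _ _) (kerB _ _ _) (varpi a xi) (xi ^+ 2 + eta) => kA kB w s e1 e2.
have e1' : s * kA = lam * kB by lra.
have e2' : lam * kA = 1 - s * kB by lra.
apply: eq_ReIm => /=.
  by transitivity (- c * w * (s * kA)); [ring|rewrite e1'; ring].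
by transitivity (c * w * (1 - s * kB)); [ring|rewrite -e2'; ring].
Qed.

Let cint_phi c : cint setT (fun xi => (varpi a xi)%:C * phi c xi) = - (c%:C * y).
Proof.
have E (k : R -> R) : measurable_fun setT k -> (forall xi, 0 <= k xi) ->
    (forall xi, k xi <= (xi ^+ 2 + eta)^-1) ->
    \int[lambda]_xi (varpi a xi * (c * (varpi a xi * k xi))) =
    c * \int[lambda]_xi (varpi a xi ^+ 2 * k xi).
  move=> mk k0 k1; rewrite -RintegralZl//; last first.
    exact: (varpi_sqr_kernel_integrable eta_gt0 a_gt0 a_lt1 mk k0 k1).
  by apply: eq_Rintegral => x _; ring.
apply: eq_ReIm; rewrite /cint /=.
  transitivity (\int[lambda]_xi (varpi a xi * (c * (varpi a xi * kerA eta lam xi)))).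
    by apply: eq_Rintegral => x _; rewrite mul0r subr0.
  by rewrite E//; [rewrite -/IA; ring|exact: measurable_kerA].
transitivity (\int[lambda]_xi (varpi a xi * (c * (varpi a xi * kerB eta lam xi)))).
  by apply: eq_Rintegral => x _; rewrite mul0r addr0.
by rewrite E//; [rewrite -/IB; ring|exact: measurable_kerB].
Qed.

Let Lin : 0 <= L <= L. Proof. by rewrite lexx ltW. Qed.

Let V_0 : V 0 = 0. Proof. by rewrite /V /pert V00 V10 mulr0 addr0. Qed.
Let P_0 : P 0 = 0. Proof. by rewrite /P /pert P00 P10 mulr0 addr0. Qed.

Lemma quasimode_Hsp : Hsp L U.
Proof.
have [LV _] := smooth_L2 L sf; have [LP _] := smooth_L2 L sg.
have hV := smooth_H1s L_gt0 sV V_0; have hP := smooth_H1s L_gt0 sP P_0.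
by split; split; [exact: hV|exact: LV|exact: L2phi|exact: hP|exact: LP|exact: L2phi].
Qed.

Let crep_f : crep L f L = 0 +i* (lam * V0 L).
Proof.
rewrite (smooth_crep L_gt0 sf Lin) /f /V /pert V1L; apply: eq_ReIm; rewrite /=; ring.
Qed.

Let crep_g : crep L g L = 0 +i* (lam * P0 L).
Proof.
rewrite (smooth_crep L_gt0 sg Lin) /g /P /pert P1L; apply: eq_ReIm; rewrite /=; ring.
Qed.

(* both boundary conditions at L, in terms of the orders 0 and 1 in y *)
Let bc (k1 k2 u0 u1 w0 w1 r c : R) : k1 * u0 - k2 * w0 = 0 -> k1 * u1 - k2 * w1 = r * c ->
  k1%:C * (u0%:C + y * u1%:C) - k2%:C * (w0%:C + y * w1%:C) = - r%:C * - (c%:C * y).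
Proof.
move=> h0 h1; have e0 : k1 * u0 = k2 * w0 by lra.
have e1 : k1 * u1 = r * c + k2 * w1 by lra.
transitivity ((k1 * u0)%:C - (k2 * w0)%:C + y * ((k1 * u1)%:C - (k2 * w1)%:C)).
  by rewrite !rmorphM; ring.
by rewrite e0 e1 !rmorphD !rmorphM /=; ring.
Qed.

Lemma quasimode_domA : domA alpha beta gamma L l1 l2 eta a U.
Proof.
split; first exact: quasimode_Hsp.
have hV := smooth_H1s L_gt0 sV V_0; have hP := smooth_H1s L_gt0 sP P_0.
have H2V : H2 L V by split; [by case: hV|by have [] := smooth_wderiv2 L_gt0 sV sVx].
have H2P : H2 L P by split; [by case: hP|by have [] := smooth_wderiv2 L_gt0 sP sPx].
have hf : H1s L f by apply: smooth_H1s sf _ => //; rewrite /f V_0 mulr0.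
have hg : H1s L g by apply: smooth_H1s sg _ => //; rewrite /g P_0 mulr0.
split; first by split.
split.
  rewrite crep_f crep_g !diffusive_phi.
  by split; [exact: L2nphi|exact: L2nphi|apply: L2_scale => //; exact: L2phi|
    apply: L2_scale => //; exact: L2phi].
rewrite (smooth_crep_wderiv L_gt0 sV sVx Lin) (smooth_crep_wderiv L_gt0 sP sPx Lin).
by rewrite !cint_phi /Vx /Px /pert; split; apply: bc.
Qed.

Let AU_E : A U = (f,
  (fun x => (alpha / rho)%:C * wderiv L (wderiv L V) x
     - (gamma * beta / rho)%:C * wderiv L (wderiv L P) x),
  (fun xi => il * phi (lam * V0 L) xi), g,
  (fun x => - (gamma * beta / mu)%:C * wderiv L (wderiv L V) x
     + (beta / mu)%:C * wderiv L (wderiv L P) x),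
  (fun xi => il * phi (lam * P0 L) xi)) :> state R.
Proof. by rewrite /A /U /opA crep_f crep_g !diffusive_phi. Qed.

Let L2V2 : L2 I (wderiv L (wderiv L V)).
Proof. by have [h _] := smooth_wderiv2 L_gt0 sV sVx; have [] := wderivP h. Qed.
Let L2P2 : L2 I (wderiv L (wderiv L P)).
Proof. by have [h _] := smooth_wderiv2 L_gt0 sP sPx; have [] := wderivP h. Qed.

Let L2_2 (c d : R[i]) (u v : R -> R[i]) : L2 I u -> L2 I v ->
  L2 I (fun x => c * u x + d * v x).
Proof. by move=> Lu Lv; apply: L2_lin => //; exact: L2_scale. Qed.

Lemma quasimode_HspA : Hsp L (A U).
Proof.
rewrite AU_E.
have hf : H1s L f by apply: smooth_H1s sf _ => //; rewrite /f V_0 mulr0.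
have hg : H1s L g by apply: smooth_H1s sg _ => //; rewrite /g P_0 mulr0.
split; split; [exact: hf| | |exact: hg| |].
- have := L2_2 (alpha / rho)%:C (- (gamma * beta / rho)%:C) L2V2 L2P2.
  by congr L2; apply/funext => x; rewrite mulNr.
- apply: L2_scale => //; exact: L2phi.
- exact: L2_2.
- apply: L2_scale => //; exact: L2phi.
Qed.

(** The quasi-mode is regular enough for its trace at 0 to be additive. *)
Lemma quasimode_sub X (c : R[i]) : Hsp L X -> Hsp L (X - c *: U).
Proof.
case: X => [[[[[v u] p1] p] w] p2] [[h1 h2 h3] [h4 h5 h6]].
have [[h1' h2' h3'] [h4' h5' h6']] := quasimode_Hsp.
rewrite addrC -scaleNr state_linE; split; split.
- exact: (H1s_addl L_gt0 (- c) h1 h1' (smooth_cont_rep L sV)).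
- exact: (L2_lin (- c) mI h2' h2).
- exact: (L2_lin (- c) mT h3' h3).
- exact: (H1s_addl L_gt0 (- c) h4 h4' (smooth_cont_rep L sP)).
- exact: (L2_lin (- c) mI h5' h5).
- exact: (L2_lin (- c) mT h6' h6).
Qed.

Let zero : R -> R[i] := cst 0.
Let res : state R := (zero, (fun x => y * (rV1 x)%:C), zero,
  zero, (fun x => y * (rP1 x)%:C), zero).

Let continuous_res (k1 k2 : R) (u uxx w wxx : R -> R) : continuous u ->
  continuous uxx -> continuous wxx ->
  continuous (fun x => k1 * uxx x + k2 * wxx x + lam ^+ 2 * u x).
Proof.
move=> c1 c2 c3 x; apply: cvgD; last by apply: cvgMr; exact: c1.
by apply: cvgD; apply: cvgMr; [exact: c2|exact: c3].
Qed.

Let crV1 : continuous rV1.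
Proof.
rewrite /rV1; under eq_fun do rewrite -mulNr.
by apply: continuous_res => //; exact: cont dV1.
Qed.

Let crP1 : continuous rP1.
Proof. by apply: continuous_res => //; exact: cont dP1. Qed.

Let L2real (u : R -> R) : continuous u -> L2 I (fun x => (u x)%:C).
Proof.
move=> cu; apply/(L2P _ mI); split; apply: continuous_L2r => //.
by move=> x; exact: cvg_cst.
Qed.

Let Hwide_res : Hwide L res.
Proof.
have h0 := smooth_H1 L_gt0 (@smooth_0 R).
split; split; [exact: h0|exact: (L2_scale y mI (L2real crV1))|exact: (L2_0 mT)|
  exact: h0|exact: (L2_scale y mI (L2real crP1))|exact: (L2_0 mT)].
Qed.

Let residual_eq : eqHsp L (A U - il *: U) res.
Proof.
have [_ aV] := smooth_wderiv2 L_gt0 sV sVx.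
have [_ aP] := smooth_wderiv2 L_gt0 sP sPx.
rewrite addrC -scaleNr AU_E state_linE; split; split.
- by apply: aeW => x Dx; rewrite mulNr addNr.
- apply: filterS2 aV aP => x e1 e2 Dx; rewrite e1// e2//.
  rewrite /f /V /Vxx /Pxx /pert /rV1 /il.
  apply: eq_ReIm => /=; last by ring.
  by apply/eqP; rewrite -subr_eq0; apply/eqP; rewrite -[RHS](eV0 x); ring.
- by apply: aeW => x Dx; rewrite mulNr addNr.
- by apply: aeW => x Dx; rewrite mulNr addNr.
- apply: filterS2 aV aP => x e1 e2 Dx; rewrite e1// e2//.
  rewrite /g /P /Vxx /Pxx /pert /rP1 /il.
  apply: eq_ReIm => /=; last by ring.
  by apply/eqP; rewrite -subr_eq0; apply/eqP; rewrite -[RHS](eP0 x); ring.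
- by apply: aeW => x Dx; rewrite mulNr addNr.
Qed.

Let lambda_I : fine (lambda I) = L.
Proof. by rewrite lebesgue_measure_itv/= lte_fin L_gt0 -EFinB subr0. Qed.

Let sqnorm_zero D : sqnorm D zero = 0.
Proof.
rewrite /sqnorm (_ : (fun x => _) = cst 0); first by rewrite /Rintegral integral0.
by apply/funext => x; rewrite /sqc /= expr0n addr0.
Qed.

Let sqnorm_res (u : R -> R) : continuous u -> (forall x, I x -> `|u x| <= C) ->
  sqnorm I (fun x => y * (u x)%:C) <= sqc y * (C ^+ 2 * L).
Proof.
move=> cu uC; rewrite sqnormZ//; last exact: L2real.
rewrite ler_wpM2l ?sqc_ge0//.
have -> : C ^+ 2 * L = \int[lambda]_(x in I) C ^+ 2 by rewrite Rintegral_cst// lambda_I.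
apply: le_Rintegral => //.
- by apply: L2_sqc_integrable; exact: L2real.
- by apply: (@continuous_integrable_itv _ L (cst (C ^+ 2))) => x; exact: cvg_cst.
move=> x Ix; rewrite /sqc /= expr0n addr0 -(real_normK (num_real (u x))).
have C0 : 0 <= C by exact: le_trans (uC x Ix).
by rewrite ler_pXn2r ?nnegrE// uC.
Qed.

Lemma quasimode_residual :
  nrm (A U - il *: U) <= normc y * Num.sqrt ((rho + mu) * (C ^+ 2 * L)).
Proof.
have hU := Hsp_Hwide quasimode_Hsp; have hAU := Hsp_Hwide quasimode_HspA.
have hX : Hwide L (A U - il *: U).
  by rewrite addrC -scaleNr; exact: Hwide_lin.
rewrite (@normH_eq _ _ _ _ _ _ _ _ _ _ _ _ hX Hwide_res residual_eq)//.
have w0 := smooth_wderiv L_gt0 (@smooth_0 R).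
rewrite (@normH_sqr _ _ _ _ _ _ _ _ _ _ _ _ _ _ _ _ _ _ Hwide_res (L2_0 mI) (L2_0 mI) w0 w0)//.
have -> : normc y = Num.sqrt (sqc y) by rewrite sqcE sqrtr_sqr ger0_norm// sqrtr_ge0.
rewrite -sqrtrM ?sqc_ge0//; apply: ler_wsqrtr; rewrite /energy.
rewrite (_ : (fun x => gamma%:C * zero x - zero x) = zero); last first.
  by apply/funext => x; rewrite /zero /= mulr0 subr0.
rewrite !sqnorm_zero !mulr0 !addr0.
have h1 := sqnorm_res crV1 rV1_le; have h2 := sqnorm_res crP1 rP1_le.
have h3 : rho * sqnorm I (fun x => y * (rV1 x)%:C) <= rho * (sqc y * (C ^+ 2 * L)).
  by rewrite ler_pM2l.
have h4 : mu * sqnorm I (fun x => y * (rP1 x)%:C) <= mu * (sqc y * (C ^+ 2 * L)).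
  by rewrite ler_pM2l.
by rewrite mulr0 addr0 mulrCA mulrDl lerD.
Qed.

Lemma quasimode_lower :
  rho * (m / 2 - sqc y * (C ^+ 2 * L)) <= nrm U ^+ 2.
Proof.
have hU := Hsp_Hwide quasimode_Hsp.
have [_ LVx] := smooth_L2 L sV; have [_ LPx] := smooth_L2 L sP.
have [Lf _] := smooth_L2 L sf.
rewrite (@normH_sqr _ _ _ _ _ _ _ _ _ _ _ _ _ _ _ _ _ _ hU LVx LPx (smooth_wderiv L_gt0 sV)
  (smooth_wderiv L_gt0 sP))//.
rewrite sqr_sqrtr; last exact: energy_ge0.
apply: (@le_trans _ _ (rho * sqnorm I f)); last first.
  rewrite /energy -!addrA lerDl; move: kappa (kappa_gt0 a_gt0 a_lt1) => k k0.
  by rewrite !(addr_ge0, mulr_ge0)// ?sqnorm_ge0 ?ltW.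
rewrite ler_pM2l//.
have cV : continuous V0 := cont dV0.
have i1 : lambda.-integrable I (EFin \o (fun x => (lam * V0 x) ^+ 2)).
  apply: continuous_integrable_itv => x.
  by apply: cvgM; apply: cvgMr; exact: cV.
have i1' := integrableZr 2^-1 mI i1.
have i2 : lambda.-integrable I (EFin \o (cst (sqc y * C ^+ 2))).
  by apply: continuous_integrable_itv => x; exact: cvg_cst.
apply: (@le_trans _ _
  (\int[lambda]_(x in I) (2^-1 * (lam * V0 x) ^+ 2 - cst (sqc y * C ^+ 2) x))).
  rewrite RintegralB// RintegralZl// Rintegral_cst// lambda_I mulrA.
  by rewrite lerD2r mulrC ler_pM2l.
apply: le_Rintegral => //.
- apply: (eq_integrable _ _ _ _ (integrableB _ i1' i2)) => //.
- exact: L2_sqc_integrable.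
move=> x Ix; have hC := V1_le Ix.
have C0 : 0 <= C by exact: le_trans hC.
have hC2 : (lam * V1 x) ^+ 2 <= C ^+ 2.
  by rewrite -(real_normK (num_real _)) ler_pXn2r ?nnegrE.
rewrite /f sqcM /V /pert /il /sqc /= expr0n add0r.
set p := - IA; set q := - IB.
apply: (@le_trans _ _ (2^-1 * (lam * V0 x) ^+ 2 - (p ^+ 2 + q ^+ 2) * (lam * V1 x) ^+ 2)).
  by rewrite lerB// ler_wpM2l// addr_ge0 ?sqr_ge0.
rewrite -subr_ge0.
have -> : lam ^+ 2 *
   ((V0 x + (p * V1 x - q * 0)) ^+ 2 + (0 + (p * 0 + q * V1 x)) ^+ 2) -
  (2^-1 * (lam * V0 x) ^+ 2 - (p ^+ 2 + q ^+ 2) * (lam * V1 x) ^+ 2) =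
   2^-1 * (lam * (V0 x + 2 * p * V1 x)) ^+ 2 + 2 * (q * (lam * V1 x)) ^+ 2.
  by field.
by rewrite addr_ge0// mulr_ge0// sqr_ge0.
Qed.

(** An approximate eigenvector for i lam, with error controlled by the integrals
    of the diffusive kernels. *)
Lemma quasimode_spec (d : R) : 0 <= d ->
  `|\int[lambda]_xi (varpi a xi ^+ 2 * kerA eta lam xi)| <= d ->
  `|\int[lambda]_xi (varpi a xi ^+ 2 * kerB eta lam xi)| <= d ->
  exists U0 : state R,
  [/\ Hsp L U0, Hsp L (A U0), domA alpha beta gamma L l1 l2 eta a U0 &
      forall X c, Hsp L X -> Hsp L (X - c *: U0)] /\
  rho * (m / 2 - (2 * d) ^+ 2 * (C ^+ 2 * L)) <= nrm U0 ^+ 2 /\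
  nrm (A U0 - (0 +i* lam) *: U0) <= 2 * d * Num.sqrt ((rho + mu) * (C ^+ 2 * L)).
Proof.
move=> d0; rewrite -/IA -/IB => hIA hIB.
have IA2 : IA ^+ 2 <= d ^+ 2 by rewrite -(real_normK (num_real IA)) ler_pXn2r ?nnegrE.
have IB2 : IB ^+ 2 <= d ^+ 2 by rewrite -(real_normK (num_real IB)) ler_pXn2r ?nnegrE.
have ysq : sqc y <= (2 * d) ^+ 2.
  have -> : sqc y = IA ^+ 2 + IB ^+ 2 by rewrite /sqc /= !sqrrN.
  have -> : (2 * d) ^+ 2 = d ^+ 2 + d ^+ 2 + 2 * d ^+ 2 by ring.
  by have := sqr_ge0 d; lra.
have ynorm : normc y <= 2 * d.
  have n0 : 0 <= normc y by exact: sqrtr_ge0.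
  by rewrite -(ler_pXn2r (isT : (0 < 2)%N)) ?nnegrE ?mulr_ge0// -sqcE.
exists U; split; [split|split].
- exact: quasimode_Hsp.
- exact: quasimode_HspA.
- exact: quasimode_domA.
- exact: quasimode_sub.
- apply: le_trans quasimode_lower; rewrite ler_pM2l// lerD2l lerN2.
  by rewrite ler_wpM2r// mulr_ge0 ?sqr_ge0// ltW.
- by apply: (le_trans quasimode_residual); rewrite ler_wpM2r// sqrtr_ge0.
Qed.

End QuasiMode.

(** * Standing waves and correctors *)

Section Modes.
Variable R : realType.
Local Notation lambda := (@lebesgue_measure R).
Implicit Types (k c x L : R).

Lemma is_derive_sin_lin k c x :
  is_derive x 1 (fun x => sin (k * (x - c))) (k * cos (k * (x - c))).
Proof.
have dl : is_derive x 1 (fun x => k * (x - c)) k.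
  by apply: is_derive_eq; rewrite /GRing.scale/=; ring.
have := @is_derive1_comp _ (@sin R) _ x _ _ (is_derive_sin _) dl.
by rewrite mulrC.
Qed.

Lemma is_derive_cos_lin k c x :
  is_derive x 1 (fun x => cos (k * (x - c))) (- (k * sin (k * (x - c)))).
Proof.
have dl : is_derive x 1 (fun x => k * (x - c)) k.
  by apply: is_derive_eq; rewrite /GRing.scale/=; ring.
have := @is_derive1_comp _ (@cos R) _ x _ _ (is_derive_cos _) dl.
by rewrite mulrC mulrN.
Qed.

(** The standing wave sin (k x) / lam; writing x - 0 makes it an instance of
    is_derive_sin_lin. *)
Definition modeS k lam x : R := lam^-1 * sin (k * (x - 0)).
Definition modeSx k lam x : R := lam^-1 * (k * cos (k * (x - 0))).
Definition modeSxx k lam x : R := lam^-1 * (k * - (k * sin (k * (x - 0)))).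

(** The corrector x sin (k (x - L)) / (L k): it vanishes at 0 and L, has slope 1
    at L, and solves u'' + k^2 u = 0 up to a term bounded independently of k. *)
Definition modeT L k x : R := (L * k)^-1 * (x * sin (k * (x - L))).
Definition modeTx L k x : R :=
  (L * k)^-1 * (sin (k * (x - L)) + x * (k * cos (k * (x - L)))).
Definition modeTxx L k x : R :=
  (L * k)^-1 * (2 * (k * cos (k * (x - L))) - x * (k * (k * sin (k * (x - L))))).

Lemma is_derive_modeS k lam x : is_derive x 1 (modeS k lam) (modeSx k lam x).
Proof. exact: (is_deriveZ lam^-1 (is_derive_sin_lin k 0 x)). Qed.

Lemma is_derive_modeSx k lam x : is_derive x 1 (modeSx k lam) (modeSxx k lam x).
Proof. exact: (is_deriveZ lam^-1 (is_deriveZ k (is_derive_cos_lin k 0 x))). Qed.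

Lemma is_derive_modeT L k x : is_derive x 1 (modeT L k) (modeTx L k x).
Proof.
have h := is_deriveM (is_derive_id x 1) (is_derive_sin_lin k L x).
have h' := is_deriveZ (L * k)^-1 h.
apply: (is_derive_eq h'); rewrite /modeTx /GRing.scale/=; ring.
Qed.

Lemma is_derive_modeTx L k x : is_derive x 1 (modeTx L k) (modeTxx L k x).
Proof.
have h := is_deriveM (is_derive_id x 1) (is_deriveZ k (is_derive_cos_lin k L x)).
have h' := is_deriveZ (L * k)^-1 (is_deriveD (is_derive_sin_lin k L x) h).
apply: (is_derive_eq h'); rewrite /modeTxx /GRing.scale/= /GRing.scale/=; ring.
Qed.

Let continuous_sin_lin k c : continuous (fun x => sin (k * (x - c))).
Proof. exact: is_derive_continuous (is_derive_sin_lin k c). Qed.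

Let continuous_cos_lin k c : continuous (fun x => cos (k * (x - c))).
Proof. exact: is_derive_continuous (is_derive_cos_lin k c). Qed.

Lemma continuous_modeSxx k lam : continuous (modeSxx k lam).
Proof.
move=> x; do 2 apply: cvgMr; apply: cvgN; apply: cvgMr; exact: continuous_sin_lin.
Qed.

Lemma continuous_modeTxx L k : continuous (modeTxx L k).
Proof.
move=> x; apply: cvgMr; apply: cvgB.
  by do 2 apply: cvgMr; exact: continuous_cos_lin.
by apply: cvgM; [exact: cvg_id|do 2 apply: cvgMr; exact: continuous_sin_lin].
Qed.

Lemma modeS_eq k lam x : modeSxx k lam x + k ^+ 2 * modeS k lam x = 0.
Proof. by rewrite /modeSxx /modeS; ring. Qed.

Lemma modeT_eq L k x : 0 < L -> 0 < k ->
  modeTxx L k x + k ^+ 2 * modeT L k x = 2 / L * cos (k * (x - L)).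
Proof. by move=> L0 k0; rewrite /modeTxx /modeT; field; rewrite !gt_eqF. Qed.

Lemma modeTx_end L k : 0 < L -> 0 < k -> modeTx L k L = 1.
Proof.
move=> L0 k0; rewrite /modeTx subrr mulr0 sin0 cos0; field.
by rewrite !gt_eqF.
Qed.

Lemma modeT_end L k : modeT L k L = 0.
Proof. by rewrite /modeT subrr mulr0 sin0 !mulr0. Qed.

Lemma modeT_le L k x : 0 < k -> 0 < x < L -> `|modeT L k x| <= k^-1.
Proof.
move=> k0 /andP[x0 xL]; have L0 := lt_trans x0 xL.
have -> : modeT L k x = k^-1 * (x / L * sin (k * (x - L))).
  by rewrite /modeT; field; rewrite !gt_eqF.
rewrite normrM gtr0_norm ?invr_gt0// ler_piMr ?invr_ge0 ?(ltW k0)// normrM.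
rewrite mulr_ile1 ?sin_max// gtr0_norm ?divr_gt0//.
by rewrite ler_pdivrMr// mul1r ltW.
Qed.

(** The mean of sin^2 over (0, L), for a wave with an antinode at L. *)
Lemma integral_sin_sqr L k : 0 < L -> 0 < k -> cos (k * (L - 0)) = 0 ->
  \int[lambda]_(x in `]0, L[) sin (k * (x - 0)) ^+ 2 = L / 2.
Proof.
move=> L0 k0 cL.
pose F x := 2^-1 * (x - k^-1 * (sin (k * (x - 0)) * cos (k * (x - 0)))).
have dF x : is_derive x 1 F (sin (k * (x - 0)) ^+ 2).
  have h := is_deriveM (is_derive_sin_lin k 0 x) (is_derive_cos_lin k 0 x).
  have h' := is_deriveZ 2^-1 (is_deriveB (is_derive_id x 1) (is_deriveZ k^-1 h)).
  apply: (is_derive_eq h'); rewrite /GRing.scale/=.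
  have := cos2Dsin2 (k * (x - 0)).
  move: (sin _) (cos _) => s c e.
  have -> : 2^-1 * (1 - k^-1 * (s * - (k * s) + c * (k * c))) =
     2^-1 * (1 + s ^+ 2 - c ^+ 2) by field; rewrite gt_eqF.
  have -> : c ^+ 2 = 1 - s ^+ 2 by lra.
  by field.
have cs : continuous (fun x => sin (k * (x - 0)) ^+ 2).
  by move=> x; apply: cvgM; exact: continuous_sin_lin.
have cF : continuous F by exact: is_derive_continuous dF.
have i1 : lambda.-integrable `[0, L] (EFin \o (fun x => sin (k * (x - 0)) ^+ 2)).
  apply: continuous_compact_integrable; first exact: segment_compact.
  exact: continuous_subspaceT.
rewrite Rintegral_itv_bndo_bndc ?Rintegral_itv_obnd_cbnd//.
- rewrite /Rintegral (@continuous_FTC2 _ _ F 0 L)//.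
  + have z : k * (0 - 0) = 0 by ring.
    rewrite /F cL z sin0 -EFinB /=; field.
    by rewrite gt_eqF.
  + exact: continuous_subspaceT.
  + split; first by move=> x _; have [] := dF x.
      by apply: cvg_at_right_filter; exact: cF.
    by apply: cvg_at_left_filter; exact: cF.
  + by move=> x _; rewrite derive1E; have [] := dF x.
- by apply: integrableS i1 => //; exact: subset_itv_oc_cc.
- by apply: integrableS i1 => //; exact: subset_itv_oo_cc.
Qed.

End Modes.

Section WaveSpeeds.
Variables (R : realType) (rho alpha alpha1 beta gamma mu : R).
Hypotheses (rho_gt0 : 0 < rho) (alpha1_gt0 : 0 < alpha1) (beta_gt0 : 0 < beta).
Hypotheses (gamma_gt0 : 0 < gamma) (mu_gt0 : 0 < mu).
Hypothesis alphaE : alpha = alpha1 + gamma ^+ 2 * beta.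

(** The squares of the two wave speeds: the distinct positive roots of
    (alpha - s rho) (beta - s mu) = (gamma beta)^2. *)
Lemma wave_speeds : exists s1 s2 : R, [/\ 0 < s1, 0 < s2 & s1 != s2] /\
  (alpha - s1 * rho) * (beta - s1 * mu) = (gamma * beta) ^+ 2 /\
  (alpha - s2 * rho) * (beta - s2 * mu) = (gamma * beta) ^+ 2.
Proof.
have gb : 0 < gamma * beta by rewrite mulr_gt0.
have rm : 0 < rho * mu by rewrite mulr_gt0.
(* the discriminant of the quadratic equation in s *)
pose D := (alpha * mu - beta * rho) ^+ 2 + 4 * (rho * mu) * (gamma * beta) ^+ 2.
have D0 : 0 < D.
  by rewrite ltr_wpDl ?sqr_ge0// mulr_gt0 ?exprn_gt0// mulr_gt0.
pose q := Num.sqrt D.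
have q0 : 0 < q by rewrite sqrtr_gt0.
have q2 : q ^+ 2 = D by rewrite sqr_sqrtr// ltW.
pose t := alpha * mu + beta * rho.
have alpha0 : 0 < alpha by rewrite alphaE addr_gt0// mulr_gt0// exprn_gt0.
have t0 : 0 < t by rewrite addr_gt0// mulr_gt0.
have qt : q < t.
  rewrite -(ltr_pXn2r (isT : (0 < 2)%N)) ?nnegrE ?ltW// q2 -subr_gt0.
  have -> : t ^+ 2 - D = 4 * (rho * mu) * (alpha1 * beta).
    by rewrite /t /D alphaE; ring.
  by rewrite !mulr_gt0.
have root (e : R) : e ^+ 2 = D -> let s := (t + e) / (2 * (rho * mu)) in
    (alpha - s * rho) * (beta - s * mu) = (gamma * beta) ^+ 2.
  move=> e2 /=; apply/eqP; rewrite -subr_eq0; apply/eqP.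
  transitivity ((e ^+ 2 - D) / (4 * (rho * mu))); last by rewrite e2 subrr mul0r.
  by rewrite /t /D; field; rewrite !gt_eqF.
exists ((t + q) / (2 * (rho * mu))), ((t + - q) / (2 * (rho * mu))).
have den : 0 < 2 * (rho * mu) by rewrite mulr_gt0.
split; first split.
- by rewrite divr_gt0// addr_gt0.
- by rewrite divr_gt0// subr_gt0.
- by rewrite gt_eqF// ltr_pM2r ?invr_gt0//; lra.
- by split; apply: root; rewrite ?sqrrN.
Qed.

(** Amplitudes of the corrector along the eigenvectors
    (gamma beta, alpha - s_j rho) for prescribed boundary fluxes. *)
Lemma corrector_amplitudes (s1 s2 e1 e2 : R) : 0 < s1 -> 0 < s2 -> s1 != s2 ->
  exists r1 r2 : R, s1 * r1 + s2 * r2 = e1 /\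
    s1 * (alpha - s1 * rho) * r1 + s2 * (alpha - s2 * rho) * r2 = e2.
Proof.
move=> s10 s20 s12.
have d0 : s1 - s2 != 0 by rewrite subr_eq0.
pose q2 := (e2 - (alpha - s1 * rho) * e1) / (rho * (s1 - s2)).
exists ((e1 - q2) / s1), (q2 / s2); rewrite /q2; split; field.
  by rewrite d0 !gt_eqF.
by rewrite d0 !gt_eqF.
Qed.

End WaveSpeeds.

(** * The quasi-mode at an antinode *)

Section AntinodeQuasiMode.
Variables (R : realType) (rho alpha alpha1 beta gamma mu L l1 l2 eta a : R).
Hypotheses (hrho : 0 < rho) (hbeta : 0 < beta) (hgamma : 0 < gamma) (hmu : 0 < mu)
  (hL : 0 < L) (hl1 : 0 < l1) (hl2 : 0 < l2) (heta : 0 < eta)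
  (ha0 : 0 < a) (ha1 : a < 1) (halpha1 : 0 < alpha1)
  (halphaE : alpha = alpha1 + gamma ^+ 2 * beta).
Local Notation lambda := (@lebesgue_measure R).
Local Notation nrm := (normH rho alpha1 beta gamma mu L l1 l2 a).
Local Notation kappa := (sin (a * pi) / pi).
Local Notation A := (opA rho alpha beta gamma mu L eta a).

(** Wave numbers k with an antinode at L: k L = pi / 2 + 2 pi n. *)
Definition wave_number (n : nat) : R := (pi / 2 + pi *+ 2 *+ n) / L.

Lemma wave_number_gt0 n : 0 < wave_number n.
Proof.
have p0 := pi_gt0 R; apply: divr_gt0 => //; apply: ltr_pwDl; first exact: divr_gt0.
by do 2 apply: mulrn_wge0; exact: ltW.
Qed.

Lemma sin_wave_number n : sin (wave_number n * (L - 0)) = 1.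
Proof.
rewrite subr0 /wave_number divfK ?gt_eqF//.
by rewrite (periodicn (@sinD2pi R)) sin_pihalf.
Qed.

Lemma cos_wave_number n : cos (wave_number n * (L - 0)) = 0.
Proof.
rewrite subr0 /wave_number divfK ?gt_eqF//.
by rewrite (periodicn (@cosD2pi R)) cos_pihalf.
Qed.

Lemma wave_number_ge n : n%:R / L <= wave_number n.
Proof.
rewrite ler_pM2r ?invr_gt0// -[n%:R]add0r lerD ?divr_ge0 ?pi_ge0//.
rewrite -[leRHS]mulr_natr ler_peMl ?ler0n//.
by rewrite mulr2n; have := @pi_ge2 R; lra.
Qed.

(** A standing wave of the first family, corrected at order one in y by both
    families so as to absorb the boundary feedback. *)
Lemma antinode_quasimode (s1 s2 r1 r2 : R) : 0 < s1 -> 0 < s2 ->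
  (alpha - s1 * rho) * (beta - s1 * mu) = (gamma * beta) ^+ 2 ->
  (alpha - s2 * rho) * (beta - s2 * mu) = (gamma * beta) ^+ 2 ->
  s1 * r1 + s2 * r2 = l1 * kappa / rho ->
  s1 * (alpha - s1 * rho) * r1 + s2 * (alpha - s2 * rho) * r2 =
    l2 * kappa * (alpha - s1 * rho) / mu ->
  exists C : R, forall k d lam : R,
  0 < k -> cos (k * (L - 0)) = 0 -> sin (k * (L - 0)) = 1 -> 0 <= d ->
  lam = Num.sqrt s1 * k ->
  `|\int[lambda]_xi (varpi a xi ^+ 2 * kerA eta lam xi)| <= d ->
  `|\int[lambda]_xi (varpi a xi ^+ 2 * kerB eta lam xi)| <= d ->
  exists U : state R,
  [/\ Hsp L U, Hsp L (A U), domA alpha beta gamma L l1 l2 eta a U &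
      forall X c, Hsp L X -> Hsp L (X - c *: U)] /\
  rho * ((gamma * beta) ^+ 2 * (L / 2) / 2 - (2 * d) ^+ 2 * (C ^+ 2 * L)) <= nrm U ^+ 2 /\
  nrm (A U - (0 +i* lam) *: U) <= 2 * d * Num.sqrt ((rho + mu) * (C ^+ 2 * L)).
Proof.
move=> s10 s20 E1 E2 F1 F2.
set sg1 := Num.sqrt s1; set sg2 := Num.sqrt s2.
set th1 := alpha - s1 * rho in E1 F2 *; set th2 := alpha - s2 * rho in E2 F2 *.
set gb := gamma * beta in E1 E2 *.
(* the three terms bound the residuals of the two wave equations and |lam V_1| *)
pose C := `|gb| * (`|s1 * r1| + `|s2 * r2|) * (2 / L) +
    (`|th1 * (s1 * r1)| + `|th2 * (s2 * r2)|) * (2 / L) +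
    `|gb| * (`|r1| * sg1 + `|r2| * sg2).
exists C => k d lam k0 ck sk d0 lamk hA hB.
have sg10 : 0 < sg1 by rewrite sqrtr_gt0.
have sg20 : 0 < sg2 by rewrite sqrtr_gt0.
have sq1 : sg1 ^+ 2 = s1 by rewrite sqr_sqrtr// ltW.
have sq2 : sg2 ^+ 2 = s2 by rewrite sqr_sqrtr// ltW.
have lam0 : 0 < lam by rewrite lamk mulr_gt0.
pose k2 := lam / sg2; have k20 : 0 < k2 by rewrite divr_gt0.
have lam1 : lam ^+ 2 = s1 * k ^+ 2 by rewrite lamk exprMn sq1.
have lam2 : lam ^+ 2 = s2 * k2 ^+ 2.
  by rewrite /k2 expr_div_n sq2 mulrCA divff ?mulr1// gt_eqF.
have [G1 G2] : beta * th1 - gb ^+ 2 = mu * (s1 * th1) /\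
               beta * th2 - gb ^+ 2 = mu * (s2 * th2).
  by rewrite -{1}E1 -E2; split; ring.
have gb0 : 0 < gb by rewrite mulr_gt0.
have n1 : 0 <= (`|s1 * r1| + `|s2 * r2|) * (2 / L).
  by rewrite mulr_ge0 ?addr_ge0// divr_ge0// ltW.
have n2 : 0 <= (`|th1 * (s1 * r1)| + `|th2 * (s2 * r2)|) * (2 / L).
  by rewrite mulr_ge0 ?addr_ge0// divr_ge0// ltW.
have n3 : 0 <= `|r1| * sg1 + `|r2| * sg2.
  by rewrite addr_ge0// mulr_ge0// ltW.
have cosb (u v : R) x : `|u * (2 / L * cos (k * (x - L))) + v * (2 / L * cos (k2 * (x - L)))|
     <= (`|u| + `|v|) * (2 / L).
  have q0 : 0 <= 2 / L by rewrite divr_ge0// ltW.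
  have b (z t : R) : `|z * (2 / L * cos t)| <= `|z| * (2 / L).
    rewrite normrM ler_wpM2l// normrM ger0_norm// ler_piMr//; exact: cos_max.
  by rewrite [leRHS]mulrDl (le_trans (ler_normD _ _))// lerD.
have TE x : modeTxx L k x = 2 / L * cos (k * (x - L)) - k ^+ 2 * modeT L k x.
  by rewrite -(modeT_eq x hL k0) addrK.
have TE2 x : modeTxx L k2 x = 2 / L * cos (k2 * (x - L)) - k2 ^+ 2 * modeT L k2 x.
  by rewrite -(modeT_eq x hL k20) addrK.
have SE x : modeSxx k lam x = - (k ^+ 2 * modeS k lam x).
  by apply/eqP; rewrite -addr_eq0 modeS_eq.
have dT2 (u v x : R) : is_derive x 1 (fun x => u * modeT L k x + v * modeT L k2 x)
    (u * modeTx L k x + v * modeTx L k2 x).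
  exact: (is_deriveD (is_deriveZ u (is_derive_modeT L k x))
                     (is_deriveZ v (is_derive_modeT L k2 x))).
have dTx2 (u v x : R) : is_derive x 1 (fun x => u * modeTx L k x + v * modeTx L k2 x)
    (u * modeTxx L k x + v * modeTxx L k2 x).
  exact: (is_deriveD (is_deriveZ u (is_derive_modeTx L k x))
                     (is_deriveZ v (is_derive_modeTx L k2 x))).
have cT2 (u v : R) : continuous (fun x => u * modeTxx L k x + v * modeTxx L k2 x).
  by move=> x; apply: cvgD; apply: cvgMr; exact: continuous_modeTxx.
have dS (u x : R) : is_derive x 1 (fun x => u * modeS k lam x) (u * modeSx k lam x).
  exact: (is_deriveZ u (is_derive_modeS k lam x)).
have dSx (u x : R) : is_derive x 1 (fun x => u * modeSx k lam x) (u * modeSxx k lam x).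
  exact: (is_deriveZ u (is_derive_modeSx k lam x)).
have cS (u : R) : continuous (fun x => u * modeSxx k lam x).
  by move=> x; apply: cvgMr; exact: continuous_modeSxx.
have lamE (u v t t' : R) :
    lam ^+ 2 * (u * t + v * t') = s1 * k ^+ 2 * (u * t) + s2 * k2 ^+ 2 * (v * t').
  by rewrite mulrDr {1}lam1 lam2.
have lamS (u : R) : lam * (u * modeS k lam L) = u.
  by rewrite /modeS sk; field; rewrite gt_eqF.
apply: (@quasimode_spec R rho alpha alpha1 beta gamma mu L l1 l2 eta a
  lam C (gb ^+ 2 * (L / 2)) hrho halpha1 hbeta hmu hL hl1 hl2 ha0 ha1 heta lam0
  (fun x => gb * modeS k lam x) (fun x => gb * modeSx k lam x)
  (fun x => gb * modeSxx k lam x)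
  (fun x => gb * r1 * modeT L k x + gb * r2 * modeT L k2 x)
  (fun x => gb * r1 * modeTx L k x + gb * r2 * modeTx L k2 x)
  (fun x => gb * r1 * modeTxx L k x + gb * r2 * modeTxx L k2 x)
  (fun x => th1 * modeS k lam x) (fun x => th1 * modeSx k lam x)
  (fun x => th1 * modeSxx k lam x)
  (fun x => th1 * r1 * modeT L k x + th2 * r2 * modeT L k2 x)
  (fun x => th1 * r1 * modeTx L k x + th2 * r2 * modeTx L k2 x)
  (fun x => th1 * r1 * modeTxx L k x + th2 * r2 * modeTxx L k2 x)
  (dS gb) (dSx gb) (cS gb) (dT2 _ _) (dTx2 _ _) (cT2 _ _)
  (dS th1) (dSx th1) (cS th1) (dT2 _ _) (dTx2 _ _) (cT2 _ _)).
- by rewrite /modeS subrr mulr0 sin0 !mulr0.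
- by rewrite /modeT !mul0r !mulr0 addr0.
- by rewrite /modeS subrr mulr0 sin0 !mulr0.
- by rewrite /modeT !mul0r !mulr0 addr0.
- by rewrite !modeT_end !mulr0 addr0.
- by rewrite !modeT_end !mulr0 addr0.
- by rewrite /modeSx ck !mulr0 subrr.
- by rewrite /modeSx ck !mulr0 subrr.
- rewrite !modeTx_end// !mulr1 lamS -/gb.
  have -> : alpha * (gb * r1 + gb * r2) - gb * (th1 * r1 + th2 * r2) =
     gb * rho * (s1 * r1 + s2 * r2) by rewrite /th1 /th2; ring.
  by rewrite F1; move: kappa => K; field; rewrite gt_eqF.
- rewrite !modeTx_end// !mulr1 lamS -/gb.
  have -> : beta * (th1 * r1 + th2 * r2) - gb * (gb * r1 + gb * r2) =
     (beta * th1 - gb ^+ 2) * r1 + (beta * th2 - gb ^+ 2) * r2 by ring.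
  rewrite G1 G2.
  have -> : mu * (s1 * th1) * r1 + mu * (s2 * th2) * r2 =
     mu * (s1 * th1 * r1 + s2 * th2 * r2) by ring.
  by rewrite F2; move: kappa => K; field; rewrite gt_eqF.
- move=> x; rewrite SE -/gb lam1 /th1; field.
  by rewrite gt_eqF.
- move=> x; rewrite SE -/gb.
  transitivity (modeS k lam x / mu * (lam ^+ 2 * mu * th1
     - k ^+ 2 * (beta * th1 - gb ^+ 2))); first by field; rewrite gt_eqF.
  by rewrite G1 lam1; ring.
- move=> x _; rewrite -/gb.
  have -> : alpha / rho * (gb * r1 * modeTxx L k x + gb * r2 * modeTxx L k2 x) -
      gb / rho * (th1 * r1 * modeTxx L k x + th2 * r2 * modeTxx L k2 x) +
      lam ^+ 2 * (gb * r1 * modeT L k x + gb * r2 * modeT L k2 x) =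
      gb * (s1 * r1 * (2 / L * cos (k * (x - L))) + s2 * r2 * (2 / L * cos (k2 * (x - L)))).
    rewrite lamE TE TE2 /th1 /th2; field.
    by rewrite !gt_eqF.
  rewrite normrM /C -addrA -[leLHS]addr0 lerD//.
    by rewrite -[leRHS]mulrA ler_wpM2l.
  by rewrite addr_ge0// mulr_ge0.
- move=> x _; rewrite -/gb.
  have -> : - (gb / mu) * (gb * r1 * modeTxx L k x + gb * r2 * modeTxx L k2 x) +
      beta / mu * (th1 * r1 * modeTxx L k x + th2 * r2 * modeTxx L k2 x) +
      lam ^+ 2 * (th1 * r1 * modeT L k x + th2 * r2 * modeT L k2 x) =
      th1 * (s1 * r1) * (2 / L * cos (k * (x - L))) +
      th2 * (s2 * r2) * (2 / L * cos (k2 * (x - L))).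
    transitivity ((beta * th1 - gb ^+ 2) / mu * r1 * modeTxx L k x +
      (beta * th2 - gb ^+ 2) / mu * r2 * modeTxx L k2 x +
      lam ^+ 2 * (th1 * r1 * modeT L k x + th2 * r2 * modeT L k2 x)).
      by field; rewrite gt_eqF.
    rewrite G1 G2 lamE TE TE2; field.
    by rewrite !gt_eqF.
  apply: (le_trans (cosb _ _ _)); rewrite /C.
  have : 0 <= `|gb| * (`|s1 * r1| + `|s2 * r2|) * (2 / L) by rewrite -mulrA mulr_ge0.
  have : 0 <= `|gb| * (`|r1| * sg1 + `|r2| * sg2) by rewrite mulr_ge0.
  by move=> w1 w2; rewrite -addrA addrCA lerDl addr_ge0.
- move=> x; rewrite /= in_itv/= => xL.
  have Tb (u q : R) (s : R) : 0 < q -> lam / q = s -> `|lam * (u * modeT L q x)| <= `|u| * s.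
    move=> q0 <-; rewrite normrM (gtr0_norm lam0) normrM mulrCA ler_wpM2l//.
    by rewrite ler_pM2l//; exact: modeT_le.
  have -> : lam * (gb * r1 * modeT L k x + gb * r2 * modeT L k2 x) =
     gb * (lam * (r1 * modeT L k x) + lam * (r2 * modeT L k2 x)) by ring.
  rewrite normrM /C; have w : `|lam * (r1 * modeT L k x) + lam * (r2 * modeT L k2 x)| <=
      `|r1| * sg1 + `|r2| * sg2.
    apply: (le_trans (ler_normD _ _)); apply: lerD; apply: Tb => //.
      by rewrite lamk mulfK// gt_eqF.
    by rewrite /k2 invf_div mulrCA divff ?mulr1// gt_eqF.
  rewrite -[leLHS]add0r lerD ?ler_wpM2l//.
  by rewrite -mulrA addr_ge0// mulr_ge0.
- have E x : (lam * (gb * modeS k lam x)) ^+ 2 = gb ^+ 2 * sin (k * (x - 0)) ^+ 2.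
    by rewrite /modeS; field; rewrite gt_eqF.
  under eq_Rintegral do rewrite E.
  rewrite RintegralZl//; first by rewrite integral_sin_sqr.
  apply: continuous_integrable_itv => x; apply: cvgM;
    exact: (is_derive_continuous (is_derive_sin_lin k 0)).
- exact: d0.
- exact: hA.
- exact: hB.
Qed.

End AntinodeQuasiMode.

(** * Absence of exponential stability *)

Section NonExponentialStability.
Variables (R : realType) (rho alpha alpha1 beta gamma mu L l1 l2 eta a : R).
Hypotheses (hrho : 0 < rho) (hbeta : 0 < beta) (hgamma : 0 < gamma) (hmu : 0 < mu)
  (hL : 0 < L) (hl1 : 0 < l1) (hl2 : 0 < l2) (heta : 0 < eta)
  (ha0 : 0 < a) (ha1 : a < 1) (halpha1 : 0 < alpha1)
  (halphaE : alpha = alpha1 + gamma ^+ 2 * beta).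
Local Notation lambda := (@lebesgue_measure R).
Local Notation nrm := (normH rho alpha1 beta gamma mu L l1 l2 a).
Local Notation kappa := (sin (a * pi) / pi).
Local Notation A := (opA rho alpha beta gamma mu L eta a).

(** Quasi-modes of energy bounded below and arbitrarily small residual. *)
Lemma quasimodes : exists2 c : R, 0 < c & forall eps : R, 0 < eps ->
  exists (lam : R) (U : state R),
  [/\ Hsp L U, Hsp L (A U), domA alpha beta gamma L l1 l2 eta a U &
      forall X k, Hsp L X -> Hsp L (X - k *: U)] /\
  c <= nrm U /\ nrm (A U - (0 +i* lam) *: U) <= eps.
Proof.
have [s1 [s2 [[s10 s20 s12] [E1 E2]]]] :=
  wave_speeds hrho halpha1 hbeta hgamma hmu halphaE.
have [r1 [r2 [F1 F2]]] := @corrector_amplitudes R rho alpha hrho s1 s2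
   (l1 * kappa / rho) (l2 * kappa * (alpha - s1 * rho) / mu) s10 s20 s12.
have [C spec] := antinode_quasimode hrho hbeta hgamma hmu hL hl1 hl2 heta ha0 ha1
  halpha1 s10 s20 E1 E2 F1 F2.
pose lam n := Num.sqrt s1 * wave_number L n.
have sg0 : 0 < Num.sqrt s1 by rewrite sqrtr_gt0.
have lam0 n : 0 < lam n by rewrite mulr_gt0// wave_number_gt0.
have lamV : (lam n)^-1 @[n --> \oo] --> (0 : R).
  apply/cvgr0Pnorm_lt => e e0; near=> n.
  rewrite gtr0_norm ?invr_gt0// invf_plt ?posrE// /lam -ltr_pdivrMl//.
  apply: (lt_le_trans _ (wave_number_ge hL n)); rewrite ltr_pdivlMr//.
  near: n; exact: nbhs_infty_gtr.
have cvA := cvg_varpi_kernel heta ha0 ha1 (measurable_kerA heta)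
  (fun l xi h => (ker_bounds heta xi h).1) lam0 lamV.
have cvB := cvg_varpi_kernel heta ha0 ha1 (measurable_kerB heta)
  (fun l xi h => (ker_bounds heta xi h).2) lam0 lamV.
pose M := C ^+ 2 * L; have M0 : 0 <= M by rewrite mulr_ge0 ?sqr_ge0// ltW.
pose K := Num.sqrt ((rho + mu) * M); have K0 : 0 <= K by rewrite sqrtr_ge0.
pose m := (gamma * beta) ^+ 2 * (L / 2) / 2.
have m0 : 0 < m by rewrite !mulr_gt0// exprn_gt0// mulr_gt0.
exists (Num.sqrt (rho * (m / 2))); first by rewrite sqrtr_gt0 mulr_gt0// divr_gt0.
move=> eps eps0.
have e1 : 0 < eps / (2 * (K + 1)) by rewrite divr_gt0// mulr_gt0// ltr_wpDl.
have e2 : 0 < m / (8 * (M + 1)) by rewrite divr_gt0// mulr_gt0// ltr_wpDl.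
(* with d <= 1 the quadratic loss in the lower bound is at most 4 d M *)
pose d := Num.min 1 (Num.min (eps / (2 * (K + 1))) (m / (8 * (M + 1)))).
have d0 : 0 < d by rewrite /d !lt_min ltr01 e1 e2.
have d1 : d <= 1 by rewrite /d ge_min lexx.
have d2 : d <= eps / (2 * (K + 1)) by rewrite /d !ge_min lexx orbT.
have d3 : d <= m / (8 * (M + 1)) by rewrite /d !ge_min lexx !orbT.
have d2' : 2 * d * K <= eps.
  move: d2; rewrite ler_pdivlMr ?mulr_gt0 ?ltr_wpDl//; nra.
have d3' : (2 * d) ^+ 2 * M <= m / 2.
  apply: (@le_trans _ _ (4 * d * M)).
    by rewrite ler_wpM2r//; nra.
  move: d3; rewrite ler_pdivlMr ?mulr_gt0 ?ltr_wpDl//; nra.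
have /cvgr0Pnorm_le/(_ _ d0) nA := cvA.
have /cvgr0Pnorm_le/(_ _ d0) nB := cvB.
have [N _ HN] := filterI nA nB.
have [hA hB] := HN N (leqnn N).
have [U [hU [lo hi]]] := spec _ d (lam N) (wave_number_gt0 hL N)
  (cos_wave_number hL N) (sin_wave_number hL N) (ltW d0) erefl hA hB.
exists (lam N), U; split; [exact: hU|split; last exact: le_trans hi d2'].
rewrite -(ler_pXn2r (isT : (0 < 2)%N)) ?nnegrE ?sqrtr_ge0 ?normH_ge0//.
rewrite sqr_sqrtr; last by apply/ltW; rewrite mulr_gt0// divr_gt0.
apply: le_trans lo; rewrite ler_pM2l// -/m -/M; lra.
Unshelve. all: by end_near. Qed.

End NonExponentialStability.

Theorem theorem3p2 (R : realType)
    (rho alpha alpha1 beta gamma mu L l1 l2 eta a : R)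
    (hrho : 0 < rho) (halpha : 0 < alpha) (hbeta : 0 < beta)
    (hgamma : 0 < gamma) (hmu : 0 < mu) (hL : 0 < L)
    (hl1 : 0 < l1) (hl2 : 0 < l2) (heta : 0 < eta)
    (ha0 : 0 < a) (ha1 : a < 1)
    (halpha1 : 0 < alpha1) (halphaE : alpha = alpha1 + gamma ^+ 2 * beta)
    (S : R -> state R -> state R)
    (hS : C0_semigroup (Hsp L) (eqHsp L)
            (normH rho alpha1 beta gamma mu L l1 l2 a) S)
    (hA : generated_by (Hsp L) (eqHsp L)
            (normH rho alpha1 beta gamma mu L l1 l2 a) S
            (domA alpha beta gamma L l1 l2 eta a)
            (opA rho alpha beta gamma mu L eta a)) :
  ~ exponentially_stable (Hsp L)
      (normH rho alpha1 beta gamma mu L l1 l2 a) S.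
Proof.
have [c c0 qm] := quasimodes hrho hbeta hgamma hmu hL hl1 hl2 heta ha0 ha1
  halpha1 halphaE.
apply: (@quasimodes_not_exponentially_stable _ _ (Hsp L) (@Hwide R L) (eqHsp L)
  _ S hS _ _ _ _ _ _ _ _ c c0).
- exact: normH_ge0.
- exact: Hsp_Hwide.
- exact: Hwide_lin.
- exact: normHZ.
- exact: normHD.
- exact: normH_eq.
- exact: Hsp_0.
- exact: Hsp_scale.
move=> eps eps0.
have [lam [U [[hU hAU dU subU] [lo hi]]]] := qm _ eps0.
exists U, (opA rho alpha beta gamma mu L eta a U), lam; split; split;
  [exact: hU|exact: Hsp_Hwide| | |exact: lo|exact: hi].
- move=> t k t0; apply: subU; exact: (C0_stable hS).
- apply/(hA U _ hU hAU); split; first exact: dU.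
  case: (opA _ _ _ _ _ _ _ _ U) => [[[[[? ?] ?] ?] ?] ?].
  by split; split; exact: ae_eq_refl.
Qed.
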